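(* The approximation problem $\mathrm{APP}=\{\mathrm{APP}_s\}_{s\in\mathbb N}$ is EC-QPT if and only if $$m_0=1,\qquad B^*:=\sup_{s\in\mathbb N}\frac{\sum_{j=1}^sb_j^{-1}}{1+\log s}<\infty,\qquad\text{and}\qquad \alpha:=\liminf_{j\to\infty}\frac{(1+\log j)\,\log a_j}{j}>0.$$ If this holds, then the exponent of EC-QPT satisfies $$t^*\in\left[\max\left(B^*,\frac{\log(1+m_1)}{\alpha}\right),\ B^*+\frac{\log(1+m_{\max})}{\alpha}\right].$$ In particular, if $\alpha=\infty$ then $t^*=B^*$.
   Context: Notation: $\mathbb N=\{1,2,\dots\}$, $\mathbb N_0=\{0,1,2,\dots\}$; $\log$ is the natural logarithm; $\alpha$ may equal $+\infty$, in which case quotients by $\alpha$ are read as $0$. Setting. $H$ is an infinite-dimensional separable Hilbert space over $\mathbb R$ or $\mathbb C$ with orthonormal basis $\{e_k\}_{k\in\mathbb N_0}$; $\omega\in(0,1)$; $\boldsymbol m=\{m_k\}_{k\in\mathbb N_0}$ is a bounded sequence of positive integers, $m_{\max}=\max_{k\in\mathbb N}m_k$; $r_0=0$ and $r_k=m_0+\cdots+m_{k-1}$ for $k\ge1$. For $n\in\mathbb N_0$ let $k(n)$ be the unique $k\in\mathbb N_0$ with $r_k\le n\le r_{k+1}-1$. For $a,b>0$ let $$H_{a,b}=\Big\{f\in H:\ \|f\|_{H_{a,b}}:=\Big(\sum_{k=0}^\infty\omega^{-ak^b}\sum_{j=r_k}^{r_{k+1}-1}|\langle f,e_j\rangle_H|^2\Big)^{1/2}<\infty\Big\}.$$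 The sequences $\boldsymbol a=\{a_j\}_{j\in\mathbb N}$, $\boldsymbol b=\{b_j\}_{j\in\mathbb N}$ consist of positive reals with $0<a_1\le a_2\le\cdots$ and $\inf_jb_j>0$. Let $H_s=H\otimes\cdots\otimes H$ ($s$-fold Hilbert tensor product) with orthonormal basis $e_{\boldsymbol n}=e_{n_1}\otimes\cdots\otimes e_{n_s}$, $\boldsymbol n\in\mathbb N_0^s$, and $H_{s,\boldsymbol a,\boldsymbol b}=H_{a_1,b_1}\otimes\cdots\otimes H_{a_s,b_s}$; equivalently, $H_{s,\boldsymbol a,\boldsymbol b}$ is the set of $f\in H_s$ with $\|f\|_{H_{s,\boldsymbol a,\boldsymbol b}}^2=\sum_{\boldsymbol n\in\mathbb N_0^s}\omega^{-\sum_{j=1}^sa_j[k(n_j)]^{b_j}}|\langle f,e_{\boldsymbol n}\rangle_{H_s}|^2<\infty$. The operator $\mathrm{APP}_s:H_{s,\boldsymbol a,\boldsymbol b}\to H_s$ is the embedding $\mathrm{APP}_sf=f$. Information complexity. For $n\in\mathbb N_0$, $e(n,\mathrm{APP}_s)=\inf_{A_n}\sup_{\|f\|_{H_{s,\boldsymbol a,\boldsymbol b}}\le1}\|f-A_nf\|_{H_s}$, the infimum being over all algorithms $A_nf=\sum_{j=1}^nL_j(f)g_j$ with continuous linear functionals $L_j$ on $H_{s,\boldsymbol a,\boldsymbol b}$ and $g_j\in H_s$ ($A_0=0$). For $\varepsilon>0$, $n(\varepsilon,\mathrm{APP}_s)=\min\{n\in\mathbb N_0:\ e(n,\mathrm{APP}_s)\le\varepsilon\}$.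 EC-QPT means that there are positive $C,t$ such that $$n(\varepsilon,\mathrm{APP}_s)\le C\exp\big(t(1+\log s)(1+\log(1+\log\varepsilon^{-1}))\big)\quad\text{for all } s\in\mathbb N,\ \varepsilon\in(0,1).$$ The infimum of the $t$ for which such a bound holds (for some $C$) is denoted $t^*$ and called the exponent of EC-QPT. *)

(* Defs.v *)
From HB Require Import structures.
From mathcomp Require Import all_boot all_order all_algebra.
From mathcomp Require Import sesquilinear complex.
From mathcomp Require Import all_classical all_reals all_analysis.
Set Implicit Arguments.
Unset Strict Implicit.
Unset Printing Implicit Defensive.
Import Order.TTheory GRing.Theory Num.Theory.
Import numFieldNormedType.Exports.
Local Open Scope classical_set_scope.
Local Open Scope ring_scope.
Local Open Scope complex_scope.

Variant scalar_kind := RealScalars | ComplexScalars.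

Definition scalar_field (R : realType) (F : scalar_kind) : numFieldType :=
  match F with RealScalars => R | ComplexScalars => R[i] end.

Definition scalar_conj (R : realType) (F : scalar_kind) :
    {rmorphism scalar_field R F -> scalar_field R F} :=
  match F with
  | RealScalars => (idfun : {rmorphism R -> R})
  | ComplexScalars => (Num.conj : {rmorphism R[i] -> R[i]})
  end.

(* Norms over [scalar_field R F] take values in [scalar_field R F]; this real part brings
   them back to [R]. *)
Definition scalar_re (R : realType) (F : scalar_kind) : scalar_field R F -> R :=
  match F with
  | RealScalars => (fun x : R => x)
  | ComplexScalars => (fun z : R[i] => complex.Re z)
  end.

(* The inner product is linear in its first argument. *)
Record hilbert (R : realType) (F : scalar_kind) := Hilbert {
  hilbert_space :> completeNormedModType (scalar_field R F) ;
  inner : {dot hilbert_space for (scalar_conj R F)} ;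
  inner_norm : forall f : hilbert_space, inner f f = `|f| ^+ 2
}.

Definition hnorm (R : realType) (F : scalar_kind) (H : hilbert R F) (f : H) : R :=
  scalar_re `|f|.

Definition linear_span (K : numFieldType) (V : lmodType K) (A : set V) : set V :=
  [set x | exists (n : nat) (c : 'I_n -> K) (v : 'I_n -> V),
     (forall i, A (v i)) /\ x = \sum_(i < n) c i *: v i].

Definition orthonormal_basis (R : realType) (F : scalar_kind) (H : hilbert R F)
    (I : eqType) (e : I -> H) : Prop :=
  (forall i j, inner H (e i) (e j) = (i == j)%:R) /\
  closure (linear_span (range e)) = setT.

(* [Hs], with [t f = f_0 (x) ... (x) f_(s-1)], is an [s]-fold Hilbert tensor
   power of [H]. These conditions characterize the pair up to a unique unitary
   isomorphism. *)
Definition tensor_power (R : realType) (F : scalar_kind) (H Hs : hilbert R F)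
    (s : nat) (t : ('I_s -> H) -> Hs) : Prop :=
  [/\ forall (f : 'I_s -> H) (j : 'I_s) (c : scalar_field R F) (x y : H),
        t (dfwith f j (c *: x + y)) =
        c *: t (dfwith f j x) + t (dfwith f j y),
      forall f g : 'I_s -> H,
        inner Hs (t f) (t g) = \prod_(j < s) inner H (f j) (g j)
    & closure (linear_span (range t)) = setT].

Definition block_start (m : nat -> nat) (k : nat) : nat := (\sum_(i < k) m i)%N.

(* The default value is irrelevant: such a [k] exists and is unique when all
   [m i] are positive. *)
Definition block_index (m : nat -> nat) (n : nat) : nat :=
  xget 0%N [set k | (block_start m k <= n <= block_start m k.+1 - 1)%N].

Section Approximation.
Context (R : realType) (F : scalar_kind) (omega : R) (m : nat -> nat)
  (a b : nat -> R).
Context (s : nat) (Hs : hilbert R F) (e : {ffun 'I_s -> nat} -> Hs).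

(* Coordinates [j : 'I_s] start at 0, the sequences [a] and [b] at 1. *)
Definition weight (n : {ffun 'I_s -> nat}) : R :=
  omega `^ (- \sum_(j < s) a j.+1 * (block_index m (n j))%:R `^ b j.+1).

(* The squared norm of the [s]-fold tensor product of the weighted spaces. *)
Definition wsqnorm (f : Hs) : \bar R :=
  \esum_(n in [set: {ffun 'I_s -> nat}])
    (weight n * scalar_re `|inner Hs f (e n)| ^+ 2)%:E.

Definition wspace : set Hs := [set f | (wsqnorm f < +oo)%E].

(* Meaningful on [wspace] only. *)
Definition wnorm (f : Hs) : R := Num.sqrt (fine (wsqnorm f)).

(* Functionals on the subspace [wspace] are functions on [Hs] whose values
   outside [wspace] are ignored; continuity is with respect to [wnorm]. *)
Definition continuous_linear_functional (L : Hs -> scalar_field R F) : Prop :=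
  (forall (c : scalar_field R F) (f g : Hs), wspace f -> wspace g ->
     L (c *: f + g) = c * L f + L g) /\
  (forall f : Hs, wspace f -> forall eta : R, 0 < eta ->
     exists2 delta : R, 0 < delta &
       forall g : Hs, wspace g -> wnorm (g - f) < delta ->
         scalar_re `|L g - L f| < eta).

Definition linear_algorithm (n : nat) : set (Hs -> Hs) :=
  [set A | exists (L : 'I_n -> Hs -> scalar_field R F) (g : 'I_n -> Hs),
     (forall j, continuous_linear_functional (L j)) /\
     (forall f, wspace f -> A f = \sum_(j < n) L j f *: g j)].

Definition worst_case_error (A : Hs -> Hs) : \bar R :=
  ereal_sup [set (hnorm (f - A f))%:E |
             f in [set f | wspace f /\ wnorm f <= 1]].

Definition minimal_error (n : nat) : \bar R :=
  ereal_inf [set worst_case_error A | A in linear_algorithm n].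

(* The least [n] such that [minimal_error n <= eps]; [+oo] if there is none. *)
Definition information_complexity (eps : R) : \bar R :=
  ereal_inf [set (n%:R : R)%:E | n in [set n | (minimal_error n <= eps%:E)%E]].

End Approximation.

Section ECQPT.
Context (R : realType) (N : nat -> R -> \bar R).

Definition ec_qpt_bound (C t : R) : Prop :=
  forall (s : nat) (eps : R), (1 <= s)%N -> 0 < eps < 1 ->
    (N s eps <=
     (C * expR (t * (1 + ln s%:R) * (1 + ln (1 + ln eps^-1))))%:E)%E.

Definition ec_qpt : Prop := exists C t : R, [/\ 0 < C, 0 < t & ec_qpt_bound C t].

Definition ec_qpt_exponent : \bar R :=
  ereal_inf [set t%:E | t in
    [set t : R | 0 < t /\ exists2 C : R, 0 < C & ec_qpt_bound C t]].

End ECQPT.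

(* For a bounded sequence the supremum is attained. *)
Definition m_max (R : realType) (m : nat -> nat) : R :=
  sup [set (m k)%:R | k in [set k | (1 <= k)%N]].

Definition Bstar (R : realType) (b : nat -> R) : \bar R :=
  ereal_sup [set ((\sum_(1 <= j < s.+1) (b j)^-1) / (1 + ln s%:R))%:E |
             s in [set s | (1 <= s)%N]].

(* The term [j = 0] is a real number and does not affect the limit inferior. The
   library's [inve +oo = 0] matches reading quotients by [alpha = +oo] as 0. *)
Definition alpha (R : realType) (a : nat -> R) : \bar R :=
  limn_einf (fun j : nat => ((1 + ln j%:R) * ln (a j) / j%:R)%:E).

(* Main.v *)
Require Import Defs.
From mathcomp Require Import all_boot all_order all_algebra.
From mathcomp Require Import sesquilinear complex.
From mathcomp Require Import all_classical all_reals all_analysis.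
From mathcomp Require Import ring lra.
Set Implicit Arguments.
Unset Strict Implicit.
Unset Printing Implicit Defensive.
Import Order.TTheory GRing.Theory Num.Theory.
Import numFieldNormedType.Exports.
Local Open Scope classical_set_scope.
Local Open Scope ring_scope.

(** The [n]-th minimal error is the square root of the [n+1]-st largest value of
    [1 / weight], so the information complexity at [eps] counts the multi-indices
    [n] with [sum_j a_j k(n_j)^(b_j) < M], where [M = 2 ln(1/eps) / ln(1/omega)]
    (the "budget").  All estimates of this count come from comparing the set with a
    box [prod_j {n_j < c_j}].

    Upper bound: only coordinates with [a_j < M] contribute, each a factor at most
    [(1 + m_max) (M / a_j)^(1/b_j)]; the growth of [a_j] limits their number among
    the first [s] to [(1 + ln s) ln M / alpha + O(1)].

    Lower bounds: letting [M] go to infinity with [s] fixed gives [B* <= t]; taking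
    [M = (s + 1) a_s], so that all of [{k(n_j) <= 1}^s] is counted, gives
    [ln (1 + m_1) / alpha <= t]; a fixed [M] gives [m_0 = 1]. *)

(** * Hilbert spaces over the two scalar fields *)

Section Scalars.
Context (R : realType) (F : scalar_kind).
Local Notation K := (scalar_field R F).
Implicit Types x y : K.

Definition sabs (x : K) : R := scalar_re `|x|.

Lemma scalar_reD x y : scalar_re (x + y) = scalar_re x + scalar_re y.
Proof. by case: F x y => //= -[a b] [c d]. Qed.

Lemma sabs_ge0 x : 0 <= sabs x.
Proof. by rewrite /sabs; case: F x => //= -[a b] /=; rewrite sqrtr_ge0. Qed.

(** In the order of [R[i]] a nonnegative element has imaginary part zero, so [scalar_re] loses
    nothing on norms. *)
Lemma scalar_re_mul_nonneg x y : 0 <= x -> 0 <= y ->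
  scalar_re (x * y) = scalar_re x * scalar_re y.
Proof.
case: F x y => //= -[a b] [c d]; rewrite !lecE /= => /andP[/eqP-> _] /andP[/eqP-> _].
by rewrite mulr0 subr0.
Qed.

Lemma scalar_re_le x y : x <= y -> scalar_re x <= scalar_re y.
Proof. by case: F x y => //= -[a b] [c d]; rewrite lecE /= => /andP[]. Qed.

Lemma sabsM x y : sabs (x * y) = sabs x * sabs y.
Proof. by rewrite /sabs normrM scalar_re_mul_nonneg. Qed.

Lemma sabsD x y : sabs (x + y) <= sabs x + sabs y.
Proof. by rewrite /sabs -scalar_reD; exact/scalar_re_le/ler_normD. Qed.

Lemma sabsN x : sabs (- x) = sabs x. Proof. by rewrite /sabs normrN. Qed.

Lemma sabs0 : sabs 0 = 0. Proof. by rewrite /sabs normr0; case: F. Qed.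

Lemma sabs_eq0 x : sabs x = 0 -> x = 0.
Proof.
rewrite /sabs => x0; apply/eqP; rewrite -normr_eq0; apply/eqP.
move: (normr_ge0 x) x0; move: `|x| => {x}; case: F => // -[a b] /=.
by rewrite lecE /= => /andP[/eqP-> _] ->.
Qed.

Lemma sabs1 : sabs 1 = 1. Proof. by rewrite /sabs normr1; case: F. Qed.

Lemma scalar_exists (r : R) : 0 <= r -> exists x : K, sabs x = r.
Proof.
rewrite /sabs; case: F => /= r0; first by exists r; rewrite ger0_norm.
by exists (real_complex R r); rewrite /= expr0n addr0 sqrtr_sqr ger0_norm.
Qed.

Lemma scalar_pos_exists (r : R) : 0 < r -> exists2 x : K, 0 < x & scalar_re x = r.
Proof.
case: F => /= r0; first by exists r.
by exists (real_complex R r) => //; rewrite ltcE /= eqxx.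
Qed.

Lemma scalar_re_lt x y : x < y -> scalar_re x < scalar_re y.
Proof. by case: F x y => //= -[a b] [c d]; rewrite ltcE /= => /andP[]. Qed.

End Scalars.

Section HilbertBasics.
Context (R : realType) (F : scalar_kind) (H : hilbert R F).
Local Notation K := (scalar_field R F).
Implicit Types (f g h : H) (c : K).

Lemma innerDl f g h : inner H (f + g) h = inner H f h + inner H g h.
Proof. exact: linearDl. Qed.

Lemma innerZl c f h : inner H (c *: f) h = c * inner H f h.
Proof. exact: linearZl_LR. Qed.

Lemma innerC f g : inner H f g = scalar_conj R F (inner H g f).
Proof. by rewrite hermitian_subproof expr0 mul1r. Qed.

Lemma innerDr f g h : inner H h (f + g) = inner H h f + inner H h g.
Proof. exact: linearDr. Qed.

Lemma innerZr c f h : inner H h (c *: f) = scalar_conj R F c * inner H h f.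
Proof. by rewrite linearZr_LR. Qed.

Lemma inner0l h : inner H 0 h = 0.
Proof. exact: linear0l. Qed.

Lemma innerBl f g h : inner H (f - g) h = inner H f h - inner H g h.
Proof. exact: linearBl. Qed.

Lemma inner_suml (I : Type) (r : seq I) (f : I -> H) h :
  inner H (\sum_(i <- r) f i) h = \sum_(i <- r) inner H (f i) h.
Proof. exact: linear_sumlz. Qed.

Lemma hnorm_sqr f : hnorm f ^+ 2 = scalar_re (inner H f f).
Proof. by rewrite inner_norm !expr2 scalar_re_mul_nonneg. Qed.

Lemma hnorm_ge0 f : 0 <= hnorm f.
Proof.
have := @scalar_re_le R F 0 `|f| (normr_ge0 f); rewrite /hnorm.
by apply: le_trans; case: F.
Qed.

Lemma hnormD f g : hnorm (f + g) <= hnorm f + hnorm g.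
Proof. by rewrite /hnorm -scalar_reD; exact/scalar_re_le/ler_normD. Qed.

Lemma hnormZ c f : hnorm (c *: f) = sabs c * hnorm f.
Proof. by rewrite /hnorm normrZ scalar_re_mul_nonneg. Qed.

Lemma hnorm_sqrD f g : inner H f g = 0 ->
  hnorm (f + g) ^+ 2 = hnorm f ^+ 2 + hnorm g ^+ 2.
Proof.
move=> fg0; have gf0 : inner H g f = 0 by rewrite innerC fg0 rmorph0.
by rewrite !hnorm_sqr innerDl !innerDr fg0 gf0 addr0 add0r scalar_reD.
Qed.

(** Balls of [H] have radii in the scalar field; this passes to real radii, so that all later
    approximation arguments take place in [R]. *)
Lemma closure_hnorm (A : set H) f :
  closure A f <-> forall r : R, 0 < r -> exists2 g, A g & hnorm (f - g) < r.
Proof.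
split=> [cf r r0|cf B].
  have [x x0 xr] := scalar_pos_exists F r0.
  have [g [Ag]] := cf _ (nbhsx_ballx f x x0).
  rewrite -ball_normE /= => /scalar_re_lt; rewrite xr; by exists g.
rewrite -nbhs_ballE => -[x /= x0 xB].
have [|g Ag fg] := cf (scalar_re x).
  have := scalar_re_lt x0; congr (_ < _); by case: F.
exists g; split => //; apply: xB; rewrite -ball_normE /=.
have : 0 <= `|f - g| by [].
move: fg x0; rewrite /hnorm; move: `|f - g|.
case: F x => //= -[a b] [c d] /=.
by rewrite !lecE !ltcE /= => ? /andP[/eqP-> _] /andP[/eqP-> _]; rewrite eqxx.
Qed.

End HilbertBasics.

(** * Orthonormal systems and finite orthogonal projections *)

Section Orthonormal.
Context (R : realType) (F : scalar_kind) (H : hilbert R F) (I : eqType)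
  (e : I -> H).
Local Notation K := (scalar_field R F).
Hypothesis e_ortho : forall i j, inner H (e i) (e j) = (i == j)%:R.
Implicit Types (f g : H) (r : seq I).

(** The orthogonal projection onto the span of the [e i] with [i] in [r], provided that [r] has no
    duplicates. *)
Definition oproj r f : H := \sum_(i <- r) inner H f (e i) *: e i.

Lemma oproj_cat r r' f : oproj (r ++ r') f = oproj r f + oproj r' f.
Proof. by rewrite /oproj big_cat. Qed.

Lemma oprojB r f g : oproj r (f - g) = oproj r f - oproj r g.
Proof.
by rewrite /oproj -sumrB; apply: eq_bigr => i _; rewrite innerBl scalerBl.
Qed.

Lemma oprojZ r (c : K) f : oproj r (c *: f) = c *: oproj r f.
Proof.
by rewrite /oproj scaler_sumr; apply: eq_bigr => i _; rewrite innerZl scalerA.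
Qed.

Lemma oproj_sum r (n : nat) (v : 'I_n -> H) :
  oproj r (\sum_(i < n) v i) = \sum_(i < n) oproj r (v i).
Proof.
rewrite /oproj exchange_big /=; apply: eq_bigr => i _.
by rewrite inner_suml scaler_suml.
Qed.

Lemma inner_comb r (c : I -> K) j : uniq r ->
  inner H (\sum_(i <- r) c i *: e i) (e j) = if j \in r then c j else 0.
Proof.
move=> ur; rewrite inner_suml; case: ifP => jr.
  rewrite (big_rem j)//= innerZl e_ortho eqxx mulr1 big1_seq ?addr0// => i /=.
  by rewrite mem_rem_uniq// inE => /andP[ij _]; rewrite innerZl e_ortho (negPf ij) mulr0.
rewrite big1_seq// => i /= ir; rewrite innerZl e_ortho.
by case: eqP ir => [->|]; rewrite ?jr ?mulr0.
Qed.

Lemma hnorm_sqr_comb r (c : I -> K) : uniq r ->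
  hnorm (\sum_(i <- r) c i *: e i) ^+ 2 = \sum_(i <- r) sabs (c i) ^+ 2.
Proof.
elim: r => [_|i r IHr /= /andP[ir ur]].
  rewrite !big_nil hnorm_sqr inner0l.
  by have := sabs0 R F; rewrite /sabs normr0.
have e1 : hnorm (e i) ^+ 2 = 1.
  by rewrite hnorm_sqr e_ortho eqxx -(sabs1 R F) /sabs normr1.
rewrite !big_cons addrC hnorm_sqrD ?IHr//.
  by rewrite hnormZ exprMn e1 mulr1 addrC.
by rewrite innerZr inner_comb// (negPf ir) mulr0.
Qed.

Lemma oproj_residue r f j : uniq r -> j \in r -> inner H (f - oproj r f) (e j) = 0.
Proof. by move=> ur jr; rewrite innerBl inner_comb// jr subrr. Qed.

(** Pythagoras: the residue is orthogonal to every [e i] with [i] in [r], hence to the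
    projection. *)
Lemma hnorm_sqr_oproj r f : uniq r ->
  hnorm f ^+ 2 = hnorm (f - oproj r f) ^+ 2 + \sum_(i <- r) sabs (inner H f (e i)) ^+ 2.
Proof.
move=> ur; rewrite -hnorm_sqr_comb// -hnorm_sqrD ?subrK//.
rewrite innerC inner_suml big1_seq ?rmorph0// => i /andP[_ ir].
by rewrite innerZl [inner H (e i) _]innerC oproj_residue// rmorph0 mulr0.
Qed.

Lemma bessel r f : uniq r ->
  \sum_(i <- r) sabs (inner H f (e i)) ^+ 2 <= hnorm f ^+ 2.
Proof. by move=> ur; rewrite (hnorm_sqr_oproj f ur) lerDr sqr_ge0. Qed.

Lemma hnorm_residue r f : uniq r -> hnorm (f - oproj r f) <= hnorm f.
Proof.
move=> ur; rewrite -(@ler_pXn2r _ 2) ?nnegrE ?hnorm_ge0//.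
by rewrite (hnorm_sqr_oproj f ur) lerDl sumr_ge0// => i _; rewrite sqr_ge0.
Qed.

Hypothesis e_dense : closure (linear_span (range e)) = setT.

(** Take the indices of a finite combination within [d] of [f]. A projection covering them fixes
    that combination, and residues do not increase the norm. *)
Lemma oproj_dense f (d : R) : 0 < d -> exists r, forall r',
  uniq r' -> {subset r <= r'} -> hnorm (f - oproj r' f) < d.
Proof.
move=> d0; have : closure (linear_span (range e)) f by rewrite e_dense.
move=> /closure_hnorm/(_ _ d0)[_ [n [c [v [ev ->]]]]] fd.
have /choice[k kv] : forall i, exists k, e k = v i.
  by move=> i; have [k _ <-] := ev i; exists k.
exists [seq k i | i <- enum 'I_n] => r' ur' sr'.
have pv : oproj r' (\sum_(i < n) c i *: v i) = \sum_(i < n) c i *: v i.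
  rewrite oproj_sum; apply: eq_bigr => i _; rewrite oprojZ -kv; congr (_ *: _).
  have kr' : k i \in r' by apply/sr'/map_f; rewrite mem_enum.
  rewrite /oproj (big_rem (k i))//= e_ortho eqxx scale1r big1_seq ?addr0// => j.
  rewrite mem_rem_uniq// inE /= => /andP[jk _].
  by rewrite e_ortho eq_sym (negPf jk) scale0r.
apply: le_lt_trans fd.
have := hnorm_residue (f - \sum_(i < n) c i *: v i) ur'.
by rewrite oprojB pv opprB addrA subrK.
Qed.

(** A finite substitute for Parseval: up to an arbitrarily small error, the residue is a finite
    combination of basis vectors outside [r], whose norm the hypothesis controls. *)
Lemma hnorm_residue_tail r f (M : R) : uniq r -> 0 <= M ->
  (forall r', uniq r' -> {in r', forall i, i \notin r} ->
     \sum_(i <- r') sabs (inner H f (e i)) ^+ 2 <= M ^+ 2) ->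
  hnorm (f - oproj r f) <= M.
Proof.
move=> ur M0 hM; apply/ler_addgt0Pl => d d0.
have [k hk] := oproj_dense f d0.
pose r' := [seq i <- undup k | i \notin r].
have ur' : uniq r' by rewrite filter_uniq// undup_uniq.
have r'r : {in r', forall i, i \notin r} by move=> i; rewrite mem_filter => /andP[].
have urr' : uniq (r ++ r').
  rewrite cat_uniq ur ur' andbT /=; apply/hasPn => i; exact: r'r.
have krr' : {subset k <= r ++ r'}.
  by move=> i ik; rewrite mem_cat mem_filter mem_undup ik andbT orbN.
have := hk _ urr' krr'; rewrite oproj_cat => hd.
have -> : f - oproj r f = (f - (oproj r f + oproj r' f)) + oproj r' f.
  by rewrite opprD addrA subrK.
apply: le_trans (hnormD _ _) _; apply: lerD; first exact: ltW.
rewrite -(@ler_pXn2r _ 2) ?nnegrE ?hnorm_ge0//.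
by rewrite /oproj hnorm_sqr_comb// hM.
Qed.

End Orthonormal.

(** * The product basis of a Hilbert tensor power *)

Section TensorBasis.
Context (R : realType) (F : scalar_kind) (H Hs : hilbert R F) (s : nat)
  (t : ('I_s -> H) -> Hs) (e : nat -> H).
Local Notation K := (scalar_field R F).
Hypothesis e_basis : orthonormal_basis e.
Hypothesis t_tensor : tensor_power t.

Definition tensor_basis (n : {ffun 'I_s -> nat}) : Hs := t (fun j => e (n j)).

Lemma tensor_basis_ortho n n' :
  inner Hs (tensor_basis n) (tensor_basis n') = (n == n')%:R.
Proof.
have [_ t_inner _] := t_tensor; have [e_ortho _] := e_basis.
rewrite t_inner; case: eqP => [->|/eqP nn'].
  by apply: big1 => j _; rewrite e_ortho eqxx.
have [j nj] : exists j, n j != n' j.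
  apply/existsP; apply: contraR nn'; rewrite negb_exists => /forallP nE.
  by apply/eqP/ffunP => j; apply/eqP; have := nE j; rewrite negbK.
by rewrite (bigD1 j)//= e_ortho (negPf nj) mul0r.
Qed.

Lemma hnorm_tensor f : hnorm (t f) = \prod_j hnorm (f j).
Proof.
have [_ t_inner _] := t_tensor.
apply/eqP; rewrite -(@eqrXn2 _ 2) ?hnorm_ge0//; last first.
  by rewrite prodr_ge0// => j _; rewrite hnorm_ge0.
rewrite hnorm_sqr t_inner -prodrXl; apply/eqP.
rewrite (eq_bigr (fun j => `|f j| ^+ 2)); last by move=> j _; rewrite inner_norm.
have scalar_re_prod r (x : 'I_s -> K) : (forall j, 0 <= x j) ->
    scalar_re (\prod_(j <- r) x j) = \prod_(j <- r) scalar_re (x j).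
  move=> x0; elim: r => [|j r IHr]; last first.
    by rewrite !big_cons scalar_re_mul_nonneg ?prodr_ge0// IHr.
  by rewrite !big_nil -(sabs1 R F) /sabs normr1.
rewrite scalar_re_prod => [|j]; last by rewrite exprn_ge0.
by apply: eq_bigr => j _; rewrite expr2 scalar_re_mul_nonneg.
Qed.

(** The closed span [V] of the product basis is a closed subspace. Elementary tensors are shown to
    lie in it by replacing basis vectors with arbitrary vectors, one factor at a time; they span a
    dense subspace by assumption. *)
Lemma tensor_basis_dense : closure (linear_span (range tensor_basis)) = setT.
Proof.
have [t_lin _ t_dense] := t_tensor; have [_ e_dense] := e_basis.
pose V := closure (linear_span (range tensor_basis)).
have VP f : V f <-> forall r : R, 0 < r ->
    exists2 g, linear_span (range tensor_basis) g & hnorm (f - g) < r.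
  exact: closure_hnorm.
have span0 : linear_span (range tensor_basis) 0.
  by exists 0%N, (fun _ => 0), (fun _ => 0); split=> [[]//|]; rewrite big_ord0.
have spanD (c : K) f g : linear_span (range tensor_basis) f ->
    linear_span (range tensor_basis) g -> linear_span (range tensor_basis) (c *: f + g).
  move=> [n [x [v [hv ->]]]] [n' [x' [v' [hv' ->]]]].
  exists (n + n')%N, (fun i => match fintype.split i with inl j => c * x j | inr j => x' j end),
    (fun i => match fintype.split i with inl j => v j | inr j => v' j end); split.
    by move=> i; case: (fintype.split i).
  rewrite big_split_ord /= scaler_sumr; congr (_ + _); apply: eq_bigr => i _.
    by rewrite (unsplitK (inl i)) scalerA.
  by rewrite (unsplitK (inr i)).
have VD (c : K) f g : V f -> V g -> V (c *: f + g).
  move=> /VP hf /VP hg; apply/VP => r r0.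
  have c1 : 0 < sabs c + 1 by rewrite ltr_wpDl ?sabs_ge0.
  have [f' f'V ff'] := hf (r / 2 / (sabs c + 1)) ltac:(by rewrite !divr_gt0).
  have [g' g'V gg'] := hg (r / 2) ltac:(by rewrite divr_gt0).
  exists (c *: f' + g'); first exact: spanD.
  rewrite opprD addrACA -scalerBr; apply: le_lt_trans (hnormD _ _) _.
  rewrite [r]splitr ler_ltD// hnormZ.
  rewrite (le_trans (ler_wpM2r (hnorm_ge0 _) (_ : _ <= sabs c + 1))) ?lerDl//.
  by rewrite mulrC -ler_pdivlMr// ltW.
have V0 : V 0 by apply: subset_closure.
have Vclosed f : (forall r : R, 0 < r -> exists2 g, V g & hnorm (f - g) < r) -> V f.
  move=> hf; apply/VP => r r0.
  have [g /VP gV fg] := hf (r / 2) ltac:(by rewrite divr_gt0).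
  have [h hV gh] := gV (r / 2) ltac:(by rewrite divr_gt0).
  exists h => //; have -> : f - h = (f - g) + (g - h) by rewrite addrA subrK.
  by apply: le_lt_trans (hnormD _ _) _; rewrite [r]splitr ltrD.
(* Induction on [k]: the first [k] factors are arbitrary, the others are basis vectors. *)
have Vt k : (k <= s)%N -> forall f : 'I_s -> H,
    (forall j : 'I_s, (k <= j)%N -> exists i, f j = e i) -> V (t f).
  elim: k => [_ f fe|k IHk ks f fe].
    have /choice[n fn] : forall j, exists i, f j = e i by move=> j; exact: fe.
    apply: subset_closure; exists 1%N, (fun _ => 1), (fun _ => t f); split; last first.
      by rewrite big_ord1 scale1r.
    move=> _; exists [ffun j => n j] => //; rewrite /tensor_basis; congr t.
    by apply/funext => j; rewrite ffunE fn.
  pose j0 := Ordinal ks.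
  have tdfD (c : K) (x y : H) :
    t (dfwith f j0 (c *: x + y)) = c *: t (dfwith f j0 x) + t (dfwith f j0 y).
    exact: t_lin.
  have tdf0 : t (dfwith f j0 0) = 0.
    have := tdfD 1 0 0; rewrite !scale1r addr0 => /(congr1 (+%R^~ (- t (dfwith f j0 0)))).
    by rewrite /= subrr addrK => <-.
  have Vdf i : V (t (dfwith f j0 (e i))).
    apply: (IHk (ltnW ks)) => j kj.
    have [<-|j0j] := eqVneq j0 j; first by exists i; rewrite dfwithin.
    rewrite dfwithout//; apply: fe.
    by rewrite ltn_neqAle kj andbT; apply: contra j0j => /eqP kj'; apply/eqP/val_inj.
  have Vspan g : linear_span (range e) g -> V (t (dfwith f j0 g)).
    move=> [n [c [v [hv ->]]]]; elim/big_rec: _ => [|i g' _ IHg']; first by rewrite tdf0.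
    by have [l _ <-] := hv i; rewrite tdfD; exact: VD.
  apply: Vclosed => r r0.
  pose P := \prod_(j | j != j0) hnorm (f j).
  have P0 : 0 <= P by apply: prodr_ge0 => j _; exact: hnorm_ge0.
  have : closure (linear_span (range e)) (f j0) by rewrite e_dense.
  (* [P] may vanish, so the tolerance for the factor [j0] is divided by [P + 1]. *)
  have P1 : 0 < P + 1 by rewrite ltr_wpDl.
  move=> /closure_hnorm/(_ (r / (P + 1)) ltac:(by rewrite divr_gt0))[g gV fg].
  exists (t (dfwith f j0 g)); first exact: Vspan.
  (* By multilinearity the difference is one elementary tensor, of norm [hnorm (f j0 - g) * P]. *)
  have -> : t f - t (dfwith f j0 g) = t (dfwith f j0 (f j0 - g)).
    rewrite [f j0 - g]addrC -[- g]scaleN1r tdfD scaleN1r addrC; congr (_ + t _).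
    apply/funext => j; have [<-|j0j] := eqVneq j0 j; first by rewrite dfwithin.
    by rewrite dfwithout.
  rewrite hnorm_tensor (bigD1 j0)//= dfwithin.
  have -> : \prod_(j | j != j0) hnorm (dfwith f j0 (f j0 - g) j) = P.
    by apply: eq_bigr => j jj0; rewrite dfwithout// eq_sym.
  move: fg; rewrite ltr_pdivlMr//; apply: le_lt_trans.
  by rewrite ler_wpM2l ?hnorm_ge0// lerDl.
apply/seteqP; split=> // f _; apply: Vclosed => r r0.
have : closure (linear_span (range t)) f by rewrite t_dense.
move=> /closure_hnorm/(_ _ r0)[g [n [c [v [hv ->]]]] fg].
exists (\sum_(i < n) c i *: v i) => //.
elim/big_rec: _ => [//|i g' _ IHg']; have [l _ <-] := hv i; apply: VD => //.
by apply: (Vt s) => // j; rewrite leqNgt ltn_ord.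
Qed.

End TensorBasis.

(** * Information complexity as a count of small weights *)

Section InformationComplexity.
Context (R : realType) (F : scalar_kind) (omega : R) (m : nat -> nat)
  (a b : nat -> R).
Context (s : nat) (Hs : hilbert R F) (e : {ffun 'I_s -> nat} -> Hs).
Local Notation K := (scalar_field R F).
Local Notation I := {ffun 'I_s -> nat}.
Hypothesis omega_gt0 : 0 < omega.
Hypothesis e_ortho : forall i j, inner Hs (e i) (e j) = (i == j)%:R.
Hypothesis e_dense : closure (linear_span (range e)) = setT.
Local Notation w := (weight omega m a b).
Local Notation wsq := (wsqnorm omega m a b e).
Local Notation wspace := (wspace omega m a b e).
Local Notation wnorm := (wnorm omega m a b e).
Implicit Types (f g : Hs) (r : seq I).

(** Finite partial sums of [wsqnorm]; working with them avoids infinite sums and extended reals. *)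
Definition wsum r f : R := \sum_(i <- r) w i * sabs (inner Hs f (e i)) ^+ 2.

Lemma weight_gt0 (i : I) : 0 < w i.
Proof. exact: powR_gt0. Qed.

Lemma wsum_le_wsqnorm r f : uniq r -> ((wsum r f)%:E <= wsq f)%E.
Proof.
move=> ur; apply: esum_ge; exists [set` r]; first by split => //; exact: finite_seq.
by rewrite -fsbig_seq// sumEFin.
Qed.

Lemma wsqnorm_le f (M : R) : (forall r, uniq r -> wsum r f <= M) -> (wsq f <= M%:E)%E.
Proof.
move=> hM; apply: ge_ereal_sup => _ [A [finA _] <-].
by rewrite fsbig_finite// sumEFin lee_fin; apply: hM; exact: finmap.fset_uniq.
Qed.

Lemma wsqnorm_ge0 f : (0 <= wsq f)%E.
Proof. by have := @wsum_le_wsqnorm [::] f isT; rewrite /wsum big_nil. Qed.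

Lemma wspace_le f (M : R) : (forall r, uniq r -> wsum r f <= M) -> wspace f.
Proof. by move=> /wsqnorm_le; move/le_lt_trans; apply; rewrite ltry. Qed.

Lemma wsum_le_wnorm r f : uniq r -> wspace f -> wsum r f <= wnorm f ^+ 2.
Proof.
move=> ur fw; have f0 := wsqnorm_ge0 f.
rewrite sqr_sqrtr; last exact: fine_ge0.
rewrite -lee_fin fineK ?wsum_le_wsqnorm//.
by rewrite ge0_fin_numE.
Qed.

Lemma wspaceB f g : wspace f -> wspace g -> wspace (f - g).
Proof.
move=> fw gw; apply: (@wspace_le _ (2 * wnorm f ^+ 2 + 2 * wnorm g ^+ 2)) => r ur.
apply: le_trans (lerD (ler_wpM2l _ (wsum_le_wnorm ur fw))
                      (ler_wpM2l _ (wsum_le_wnorm ur gw))) => //.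
rewrite /wsum !mulr_sumr -big_split; apply: ler_sum => i _ /=.
rewrite innerBl; set x := inner Hs f _; set y := inner Hs g _.
rewrite [leRHS](_ : _ = w i * (2 * sabs x ^+ 2 + 2 * sabs y ^+ 2)); last by ring.
rewrite ler_wpM2l ?(ltW (weight_gt0 i))//.
have xy : sabs (x - y) <= sabs x + sabs y by rewrite -(sabsN y); exact: sabsD.
have xy0 := sabs_ge0 (x - y).
apply: (@le_trans _ _ ((sabs x + sabs y) ^+ 2)).
  by rewrite ler_pXn2r ?nnegrE// addr_ge0 ?sabs_ge0.
by have := sqr_ge0 (sabs x - sabs y); nra.
Qed.

(** One term of [wsqnorm] is at most the whole sum, so the coefficient is Lipschitz for [wnorm] with
    constant [(Num.sqrt (w i))^-1]. *)
Lemma coef_continuous i :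
  continuous_linear_functional omega m a b e (fun f => inner Hs f (e i)).
Proof.
split=> [c f g _ _|f fw eta eta0]; first by rewrite innerDl innerZl.
have w0 := weight_gt0 i; have sw0 : 0 < Num.sqrt (w i) by rewrite sqrtr_gt0.
exists (Num.sqrt (w i) * eta) => [|g gw gf]; first exact: mulr_gt0.
rewrite -innerBl -[scalar_re _]/(sabs _).
have := wsum_le_wnorm (isT : uniq [:: i]) (wspaceB gw fw).
rewrite /wsum big_seq1 -{1}[w i]sqr_sqrtr; last exact: ltW.
rewrite -exprMn.
rewrite ler_pXn2r ?nnegrE ?sqrtr_ge0 ?mulr_ge0 ?sabs_ge0 ?(ltW sw0)//.
by move=> /le_lt_trans/(_ gf); rewrite ltr_pM2l.
Qed.

(** The projection onto the [e i] with [i] in [r] is an admissible algorithm. Outside [r] a squared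
    coefficient is at most [eps ^+ 2] times its weighted value, so on the unit ball the error is at
    most [eps]. *)
Lemma information_complexity_le (eps : R) (r : seq I) : 0 < eps -> uniq r ->
  (forall i, i \notin r -> eps ^- 2 <= w i) ->
  (information_complexity omega m a b e eps <= (size r)%:R%:E)%E.
Proof.
move=> eps0 ur hr; apply: ereal_inf_lbound; exists (size r) => //=.
pose A := oproj e r.
apply: (@le_trans _ _ (worst_case_error omega m a b e A)).
  apply: ereal_inf_lbound; exists A => //=.
  pose i0 : I := [ffun=> 0%N].
  exists (fun j f => inner Hs f (e (nth i0 r j))), (fun j => e (nth i0 r j)).
  split=> [j|f _]; first exact: coef_continuous.
  by rewrite /A /oproj (big_nth i0) big_mkord.
apply: ge_ereal_sup => _ [f [fw f1] <-]; rewrite lee_fin.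
apply: (hnorm_residue_tail e_ortho e_dense ur (ltW eps0)) => r' ur' r'r.
have := wsum_le_wnorm ur' fw.
have f2 : wnorm f ^+ 2 <= 1 by rewrite expr_le1// sqrtr_ge0.
move=> /le_trans/(_ f2) h.
rewrite -[leRHS]mulr1; apply: le_trans (ler_wpM2l (sqr_ge0 eps) h).
rewrite /wsum mulr_sumr big_seq [leRHS]big_seq; apply: ler_sum => i ir'.
rewrite mulrA ler_peMl ?sqr_ge0//.
by rewrite mulrC -ler_pdivrMr ?exprn_gt0// div1r hr// r'r.
Qed.

(** On the span of basis vectors of weight at most [W], the weighted squared norm is at most [W]
    times the plain one. *)
Lemma wsum_comb r r' (c : I -> K) (W : R) : uniq r -> uniq r' ->
  (forall i, i \in r -> w i <= W) -> 0 <= W ->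
  wsum r' (\sum_(i <- r) c i *: e i) <= W * \sum_(i <- r) sabs (c i) ^+ 2.
Proof.
move=> ur ur' wW W0; rewrite -(hnorm_sqr_comb e_ortho c ur).
apply: le_trans (ler_wpM2l W0 (bessel e_ortho _ ur')).
rewrite /wsum mulr_sumr; apply: ler_sum => i _; rewrite (inner_comb e_ortho)//.
case: ifP => ir; first by rewrite ler_wpM2r ?sqr_ge0// wW.
by rewrite sabs0 expr0n !mulr0.
Qed.

Lemma wspace_comb r (c : I -> K) : uniq r -> wspace (\sum_(i <- r) c i *: e i).
Proof.
move=> ur; pose W := \sum_(i <- r) w i.
apply: (@wspace_le _ (W * \sum_(i <- r) sabs (c i) ^+ 2)) => r' ur'.
apply: (wsum_comb c ur ur').
  move=> i ir; rewrite /W (big_rem i)//= lerDl; apply: sumr_ge0 => j _.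
  exact/ltW/weight_gt0.
by apply: sumr_ge0 => j _; exact/ltW/weight_gt0.
Qed.

(** Linearity of [L] is given on [wspace] only, so the induction checks that each partial
    combination lies there. *)
Lemma functional_comb (L : Hs -> K) r (c : I -> K) : uniq r ->
  continuous_linear_functional omega m a b e L ->
  L (\sum_(i <- r) c i *: e i) = \sum_(i <- r) c i * L (e i).
Proof.
move=> ur [Llin _]; have w0 : wspace 0.
  by have := @wspace_comb [::] (fun=> 0) isT; rewrite big_nil.
have L0 : L 0 = 0.
  by apply: (@addrI _ (L 0)); rewrite addr0 -[X in X + _]mul1r -Llin// scaler0 addr0.
elim: r ur => [|i r IHr /= /andP[ir ur]]; first by rewrite !big_nil.
rewrite !big_cons Llin ?IHr//; last exact: wspace_comb.
by have := @wspace_comb [:: i] (fun=> 1) isT; rewrite big_seq1 scale1r.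
Qed.

(** The matrix of values of [n] functionals on more than [n] basis vectors has a nonzero row vector
    in its left kernel. *)
Lemma functionals_common_kernel n (L : 'I_n -> Hs -> K) r :
  (n < size r)%N -> uniq r ->
  (forall j, continuous_linear_functional omega m a b e (L j)) ->
  exists c : I -> K, [/\ 0 < \sum_(i <- r) sabs (c i) ^+ 2 &
    forall j, L j (\sum_(i <- r) c i *: e i) = 0].
Proof.
move=> nr ur hL; pose i0 : I := [ffun=> 0%N].
pose A := (\matrix_(k < size r, j < n) L j (e (nth i0 r k))).
have /rowV0Pn[v /sub_kermxP vA v0] : kermx A != 0.
  rewrite kermx_eq0 -row_leq_rank -ltnNge.
  by apply: leq_ltn_trans (rank_leq_col _) nr.
(* Carries the kernel vector from list positions to multi-indices; the default 0 applies outside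
   [r]. *)
pose c i := if insub (index i r) is Some k then v 0 k else 0.
have cE (k : 'I_(size r)) : c (nth i0 r k) = v 0 k.
  by rewrite /c index_uniq// valK.
exists c; split=> [|j].
  rewrite lt_neqAle sumr_ge0 ?andbT => [|i _]; last exact: sqr_ge0.
  apply: contra v0; rewrite eq_sym psumr_eq0 => [/allP vz|i _]; last exact: sqr_ge0.
  apply/eqP/rowP => k; rewrite mxE -cE.
  have := vz (nth i0 r k) (mem_nth _ (ltn_ord k)); rewrite sqrf_eq0 => /eqP.
  exact: sabs_eq0.
rewrite functional_comb// (big_nth i0) big_mkord.
have := congr1 (fun B : 'rV_n => B 0 j) vA; rewrite !mxE; apply: etrans.
by apply: eq_bigr => k _; rewrite cE mxE.
Qed.

(** Fooling argument: a vector in the span over [r] on which all functionals vanish is sent to 0. It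
    can have [hnorm] equal to [Num.sqrt W^-1] while its weighted norm stays at most 1. *)
Lemma minimal_error_ge (W : R) r n : 0 < W -> uniq r -> (n < size r)%N ->
  (forall i, i \in r -> w i <= W) ->
  ((Num.sqrt W^-1)%:E <= minimal_error omega m a b e n)%E.
Proof.
move=> W0 ur nr rW; apply: le_ereal_inf_tmp => _ [A [L [g [hL hA]]] <-].
have [c [c0 cL]] := functionals_common_kernel nr ur hL.
set S := (X in 0 < X) in c0.
(* The factor [x] rescales the kernel vector so that its squared norm becomes [W^-1]. *)
have [x xE] : exists x : K, sabs x = Num.sqrt (W^-1 / S).
  by apply: scalar_exists; exact: sqrtr_ge0.
have WS0 : 0 < W^-1 / S by rewrite divr_gt0// invr_gt0.
pose f := \sum_(i <- r) (x * c i) *: e i.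
have SE : \sum_(i <- r) sabs (x * c i) ^+ 2 = W^-1.
  under eq_bigr do rewrite sabsM exprMn.
  by rewrite -mulr_sumr xE sqr_sqrtr ?ltW// mulfVK// gt_eqF.
have fw : wspace f by exact: wspace_comb.
have f1 : wnorm f <= 1.
  rewrite -sqrtr1 ler_wsqrtr// -lee_fin fineK; last first.
    by rewrite ge0_fin_numE ?wsqnorm_ge0.
  apply: wsqnorm_le => r' ur'; have := wsum_comb (fun i => x * c i) ur ur' rW (ltW W0).
  by rewrite SE mulfV ?gt_eqF.
have Af0 : A f = 0.
  rewrite hA// big1// => j _.
  suff -> : L j f = x * L j (\sum_(i <- r) c i *: e i) by rewrite cL mulr0 scale0r.
  rewrite !functional_comb// mulr_sumr; apply: eq_bigr => i _; by rewrite mulrA.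
apply: ereal_sup_ubound; exists f => //; congr (_%:E).
rewrite Af0 subr0 -SE -(hnorm_sqr_comb e_ortho)// sqrtr_sqr ger0_norm// hnorm_ge0 //.
Qed.

Lemma information_complexity_ge (eps : R) (r : seq I) : 0 < eps -> uniq r ->
  (forall i, i \in r -> w i < eps ^- 2) ->
  ((size r)%:R%:E <= information_complexity omega m a b e eps)%E.
Proof.
move=> eps0 ur hr; apply: le_ereal_inf_tmp => _ [n /= hn <-].
rewrite lee_fin ler_nat leqNgt; apply/negP => nr.
have r0 : r != [::] by case: r nr {ur hr}.
(* The largest weight on [r]; as [r] is finite, it is still strictly below [eps ^- 2]. *)
have [W [W0 We rW]] : exists W, [/\ 0 < W, W < eps ^- 2 &
    forall i, i \in r -> w i <= W].
  elim: r hr r0 {ur nr} => // i r IHr hr _.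
  have [->|r0] := eqVneq r [::].
    exists (w i); split=> [||j]; [exact: weight_gt0|by rewrite hr ?mem_head|].
    by rewrite inE => /eqP->.
  have [|//|W [W0 We rW]] := IHr; first by move=> j jr; apply: hr; rewrite inE jr orbT.
  exists (Num.max (w i) W); split=> [||j]; first by rewrite lt_max W0 orbT.
    by rewrite gt_max We hr// mem_head.
  rewrite inE le_max => /predU1P[->|/rW->]; first by rewrite lexx.
  by rewrite orbT.
have := le_trans (minimal_error_ge W0 ur nr rW) hn.
rewrite lee_fin leNgt => /negP; apply.
rewrite -[ltLHS]ger0_norm ?(ltW eps0)// -sqrtr_sqr ltr_sqrt ?invr_gt0//.
by rewrite -ltf_pV2 ?posrE ?invr_gt0 ?exprn_gt0// invrK.
Qed.

End InformationComplexity.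

(** * Block indices and boxes of multi-indices *)

Section Blocks.
Variable m : nat -> nat.
Hypothesis m_gt0 : forall k, (0 < m k)%N.

Lemma block_start_mono : {homo block_start m : k l / (k <= l)%N}.
Proof.
move=> k l kl; rewrite /block_start -(subnKC kl) big_split_ord /=.
exact: leq_addr.
Qed.

Lemma leq_block_start k : (k <= block_start m k)%N.
Proof.
by elim: k => // k IHk; rewrite /block_start big_ord_recr /= -addn1 leq_add.
Qed.

Lemma block_indexP n :
  (block_start m (block_index m n) <= n < block_start m (block_index m n).+1)%N.
Proof.
have exk : exists k, (n < block_start m k.+1)%N by exists n; exact: leq_block_start.
(* The subtraction is truncated, which is harmless because [block_start m k.+1] is positive. *)
have bE k : (n <= block_start m k.+1 - 1)%N = (n < block_start m k.+1)%N.
  have := leq_block_start k.+1; case: (block_start m k.+1) => // l _.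
  by rewrite subn1.
rewrite -bE; apply: (@xgetPex _ 0%N [set k | (block_start m k <= n <= block_start m k.+1 - 1)%N]).
case: (ex_minnP exk) => k nk kmin; exists k => /=; rewrite bE nk andbT.
case: k kmin {nk} => [|k] kmin; first by rewrite /block_start big_ord0.
by rewrite leqNgt; apply/negP => /kmin; rewrite ltnn.
Qed.

(** Turns a bound on the block index into a bound on [n], which is the form taken by the sides of a
    box. *)
Lemma block_index_leP n k : (block_index m n <= k)%N = (n < block_start m k.+1)%N.
Proof.
have /andP[kn nk] := block_indexP n; apply/idP/idP => h.
  by apply: leq_trans nk _; exact: block_start_mono.
rewrite leqNgt; apply/negP => /block_start_mono /(leq_trans h).
by rewrite ltnNge kn.
Qed.

Lemma block_index_le n : (block_index m n <= n)%N.
Proof. by rewrite block_index_leP leq_block_start. Qed.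

Lemma block_start1 : block_start m 1 = m 0%N.
Proof. by rewrite /block_start big_ord1. Qed.

Lemma block_start2 : block_start m 2 = (m 0 + m 1)%N.
Proof. by rewrite /block_start big_ord_recr big_ord1. Qed.

End Blocks.

(** The box is enumerated as a family of functions into the finite type ['I_B], where [B] exceeds
    every side. *)
Lemma ffun_box (s : nat) (c : 'I_s -> nat) : exists r : seq {ffun 'I_s -> nat},
  [/\ uniq r, size r = (\prod_j c j)%N &
    forall i, (i \in r) = [forall j, (i j < c j)%N]].
Proof.
pose B := (\max_j c j).+1.
have cB j : (c j <= B)%N by apply: leqW; exact: leq_bigmax.
pose P j := [pred x : 'I_B | (x < c j)%N].
pose val_ffun (g : {ffun 'I_s -> 'I_B}) : {ffun 'I_s -> nat} := [ffun j => nat_of_ord (g j)].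
have val_ffun_inj : injective val_ffun.
  move=> g g' /ffunP gg'; apply/ffunP => j; apply/val_inj.
  by have := gg' j; rewrite !ffunE.
exists (map val_ffun (enum (family P))); split.
- by rewrite map_inj_uniq// enum_uniq.
- rewrite size_map -cardE card_family foldrE big_map -/(index_enum _).
  rewrite big_enum /=; apply: eq_bigr => j _.
  rewrite -sum1_card (eq_bigl (fun x : 'I_B => (x < c j)%N))//.
  by rewrite -(big_ord_widen _ (fun=> 1%N))// sum1_card card_ord.
- move=> i; apply/mapP/forallP => [[g]|ic].
    by rewrite mem_enum => /familyP gP -> j; rewrite ffunE; exact: gP.
  exists [ffun j => Ordinal (leq_trans (ic j) (cB j))].
    by rewrite mem_enum; apply/familyP => j; rewrite ffunE; exact: ic.
  by apply/ffunP => j; rewrite !ffunE.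
Qed.

(** * Complexity bounds from boxes of affordable multi-indices *)

Section Budget.
Context (R : realType) (F : scalar_kind) (omega : R) (m : nat -> nat)
  (a b : nat -> R) (H : hilbert R F) (e : nat -> H) (s : nat) (Hs : hilbert R F)
  (t : ('I_s -> H) -> Hs).
Hypothesis omega01 : 0 < omega < 1.
Hypothesis e_basis : orthonormal_basis e.
Hypothesis t_tensor : tensor_power t.
Hypothesis m_gt0 : forall k, (0 < m k)%N.
Hypothesis a_gt0 : forall j, (1 <= j)%N -> 0 < a j.
Local Notation N eps := (information_complexity omega m a b
  (fun n : {ffun 'I_s -> nat} => t (fun j => e (n j))) eps).

Definition budget (eps : R) : R := 2 * ln eps^-1 / ln omega^-1.

Definition cost (n : {ffun 'I_s -> nat}) : R :=
  \sum_(j < s) a j.+1 * (block_index m (n j))%:R `^ b j.+1.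

Lemma ln_omegaV_gt0 : 0 < ln omega^-1.
Proof.
by have /andP[w0 w1] := omega01; rewrite ln_gt0// invf_gt1.
Qed.

Lemma weight_lt_budget (eps : R) n : 0 < eps ->
  (weight omega m a b n < eps ^- 2) = (cost n < budget eps).
Proof.
move=> eps0; have /andP[w0 w1] := omega01.
rewrite -ltr_ln ?posrE ?invr_gt0 ?exprn_gt0//; last exact: powR_gt0.
rewrite /weight ln_powR -/(cost n) -exprVn lnXn ?invr_gt0// /budget.
rewrite ltr_pdivlMr ?ln_omegaV_gt0// [ln omega^-1]lnV ?posrE//.
by rewrite mulr_natl mulrN mulNr.
Qed.

Lemma cost_coord_le (n : {ffun 'I_s -> nat}) (j : 'I_s) :
  a j.+1 * (block_index m (n j))%:R `^ b j.+1 <= cost n.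
Proof.
rewrite /cost (bigD1 j)//= lerDl; apply: sumr_ge0 => i _.
by rewrite mulr_ge0 ?powR_ge0// ltW// a_gt0.
Qed.

(** A multi-index outside the box has a coordinate that alone exhausts the budget, since all costs
    are nonnegative. *)
Lemma complexity_le_box (eps : R) (c : 'I_s -> nat) : 0 < eps ->
  (forall (j : 'I_s) k, (c j <= k)%N ->
     budget eps <= a j.+1 * (block_index m k)%:R `^ b j.+1) ->
  (N eps <= (\prod_j c j)%:R%:E)%E.
Proof.
move=> eps0 hc; have [r [ur <- rE]] := ffun_box c.
have /andP[w0 _] := omega01.
apply: (information_complexity_le w0 (tensor_basis_ortho e_basis t_tensor)
  (tensor_basis_dense e_basis t_tensor) eps0 ur).
move=> n; rewrite rE negb_forall => /existsP[j]; rewrite -leqNgt => cj.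
rewrite leNgt weight_lt_budget// -leNgt; apply: le_trans (hc _ _ cj) _.
exact: cost_coord_le.
Qed.

Lemma complexity_ge_box (eps : R) (c : 'I_s -> nat) : 0 < eps ->
  (forall n : {ffun 'I_s -> nat}, (forall j, (n j < c j)%N) -> cost n < budget eps) ->
  ((\prod_j c j)%:R%:E <= N eps)%E.
Proof.
move=> eps0 hc; have [r [ur <- rE]] := ffun_box c.
have /andP[w0 _] := omega01.
apply: (information_complexity_ge w0 (tensor_basis_ortho e_basis t_tensor)
  eps0 ur).
by move=> n; rewrite rE => /forallP nc; rewrite weight_lt_budget// hc.
Qed.

End Budget.

(** * Asymptotics of the count *)

Section RealLemmas.
Context {R : realType}.
Implicit Types (x : R) (n : nat).

Lemma ln_natr_ge0 n : 0 <= ln n%:R :> R.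
Proof. by case: n => [|n]; [rewrite ln0|rewrite ln_ge0// ler1n]. Qed.

Lemma ln_natr_le (k n : nat) : (k <= n)%N -> ln k%:R <= ln n%:R :> R.
Proof.
case: k => [_|k kn]; first by rewrite ln0 ?ln_natr_ge0.
by rewrite ler_ln ?posrE ?ltr0n ?ler_nat// (leq_trans _ kn).
Qed.

(** Apply [ln (1 + y) <= y] to the square root of [x]. Such explicit bounds replace limits of
    quotients below; the fourth-root version serves for products of two logarithms. *)
Lemma ln_le_sqrt x : 0 < x -> ln x <= 2 * (Num.sqrt x - 1).
Proof.
move=> x0; have s0 : 0 < Num.sqrt x by rewrite sqrtr_gt0.
rewrite -{1}(sqr_sqrtr (ltW x0)) lnXn// mulr_natl ler_wMn2r//.
by have := @le_ln1Dx R (Num.sqrt x - 1); rewrite [1 + _]addrC subrK; apply; lra.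
Qed.

Lemma ln_le_sqrt_sqrt x : 0 < x -> ln x <= 4 * (Num.sqrt (Num.sqrt x) - 1).
Proof.
move=> x0; have s0 : 0 < Num.sqrt x by rewrite sqrtr_gt0.
rewrite -{1}(sqr_sqrtr (ltW x0)) lnXn// -mulr_natl.
by have := ln_le_sqrt s0; lra.
Qed.

End RealLemmas.

(** * Upper estimates for the logarithm of the count *)

Section LogCount.
Context (R : realType) (a b : nat -> R) (lm alp : R) (J : nat).
Hypothesis a_gt0 : forall j, (1 <= j)%N -> 0 < a j.
Hypothesis b_gt0 : forall j, (1 <= j)%N -> 0 < b j.
Hypothesis lm_ge0 : 0 <= lm.
Hypothesis alp_gt0 : 0 < alp.
Hypothesis a_growth : forall j, (J <= j)%N -> alp * j%:R <= (1 + ln j%:R) * ln (a j).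

(** The logarithm of the product of [(1 + m_max) * (M / a_j)^(1/b_j)] over the [j] with [a_j < M],
    where [lm] stands for [ln (1 + m_max)]. *)
Definition log_count (s : nat) (M : R) : R :=
  \sum_(j < s | a j.+1 < M) (lm + (ln M - ln (a j.+1)) / b j.+1).

Lemma ln_a_ge0 j : (J <= j)%N -> 0 <= ln (a j).
Proof.
move=> Jj; rewrite -(@pmulr_rge0 _ (1 + ln j%:R)).
  by apply: le_trans (a_growth Jj); rewrite mulr_ge0// ltW.
by rewrite ltr_pwDl// ln_natr_ge0.
Qed.

(** With [1 + ln j <= 2 * sqrt j], the growth hypothesis gives [alp * sqrt j <= 2 * ln (a j)]. *)
Lemma ln_a_cvg (P : R) : exists J1, forall j, (J1 <= j)%N -> P < ln (a j).
Proof.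
pose Q := (2 * `|P| / alp + 1).
have Q1 : 1 <= Q by rewrite lerDr mulr_ge0// ?invr_ge0 ltW// mulr_ge0.
exists (maxn J (Num.truncn (Q ^+ 2)).+1) => j; rewrite geq_max => /andP[Jj Qj].
have j0 : (0 < j)%N by apply: leq_trans Qj.
have jQ : Q ^+ 2 < j%:R.
  by apply: lt_le_trans (truncnS_gt _) _; rewrite ler_nat.
set v := Num.sqrt (j%:R : R).
have vQ : Q < v by rewrite /v -[ltLHS]ger0_norm ?(le_trans ler01)// -sqrtr_sqr ltr_sqrt ?ltr0n.
have vv : v ^+ 2 = j%:R by rewrite sqr_sqrtr.
have lnj : ln j%:R <= 2 * (v - 1) by apply: ln_le_sqrt; rewrite ltr0n.
have Pn := ler_norm P.
have := a_growth Jj; rewrite -{1}vv => h1.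
have h2 : (1 + ln j%:R) * ln (a j) <= 2 * v * ln (a j).
  by rewrite ler_wpM2r ?ln_a_ge0//; lra.
have v0 : 0 < v by lra.
have h3 : alp * v <= 2 * ln (a j).
  by rewrite -(ler_pM2r v0) -mulrA -expr2; apply: le_trans h1 _; rewrite [leRHS]mulrAC; exact: h2.
have : 2 * `|P| < alp * v.
  by rewrite [ltRHS]mulrC -ltr_pdivrMr//; rewrite /Q in vQ; lra.
lra.
Qed.

(** Induction on [s]: if the last index is counted, the growth hypothesis at that index bounds [s]
    itself; otherwise the count is unchanged. Indices below [J] cost at most [J]. *)
Lemma count_le (s : nat) (M : R) :
  \sum_(j < s | a j.+1 < M) 1 <= J%:R + (1 + ln s%:R) * Num.max 0 (ln M) / alp.
Proof.
set p := Num.max _ _; have p0 : 0 <= p by rewrite /p le_max lexx.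
have rhs0 n : 0 <= (1 + ln n%:R) * p / alp.
  by rewrite mulr_ge0 ?invr_ge0 ?(ltW alp_gt0)// mulr_ge0// addr_ge0// ln_natr_ge0.
have cnt n : \sum_(j < n | a j.+1 < M) 1 <= n%:R :> R.
  rewrite big_mkcond /=; apply: (@le_trans _ _ (\sum_(j < n) 1)).
    by apply: ler_sum => j _; case: ifP.
  by rewrite sumr_const card_ord.
elim: s => [|s IHs]; first by rewrite big_ord0 addr_ge0.
have [sJ|Js] := ltnP s.+1 J.
  by apply: le_trans (cnt _) _; rewrite -[leLHS]addr0 lerD// ler_nat ltnW.
case: (ltP (a s.+1) M) => asM; last first.
  rewrite big_mkcond big_ord_recr/= ltNge asM addr0 -big_mkcond.
  apply: le_trans IHs _; rewrite lerD2l ler_wpM2r ?invr_ge0 ?(ltW alp_gt0)//.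
  by rewrite ler_wpM2r// lerD2l ln_natr_le.
apply: le_trans (cnt _) _; rewrite -[leLHS]add0r lerD//.
rewrite ler_pdivlMr// mulrC; apply: le_trans (a_growth Js) _.
rewrite ler_wpM2l ?addr_ge0 ?ln_natr_ge0// /p le_max; apply/orP; right.
have a0 := a_gt0 (isT : (1 <= s.+1)%N).
by apply/ltW; rewrite ltr_ln ?posrE// (lt_trans a0).
Qed.

Lemma log_count_le (B : R) :
  (forall s, (1 <= s)%N -> \sum_(j < s) (b j.+1)^-1 <= B * (1 + ln s%:R)) ->
  exists A, forall s M, (1 <= s)%N ->
    log_count s M <= A + (1 + ln s%:R) * Num.max 0 (ln M) * (B + lm / alp).
Proof.
(* Only coordinates numbered below [J] can have [ln (a j) < 0]; [A0] pays for them. *)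
move=> hB; pose A0 := \sum_(j < J) `|ln (a j.+1)| / b j.+1.
exists (A0 + J%:R * lm) => s M s1; rewrite /log_count.
set p := Num.max _ _; have p0 : 0 <= p by rewrite /p le_max lexx.
have bV j : 0 <= (b j.+1)^-1 by rewrite invr_ge0 ltW// b_gt0.
have split_le (j : 'I_s) : a j.+1 < M ->
    lm + (ln M - ln (a j.+1)) / b j.+1 <=
    1 * lm + (p * (b j.+1)^-1 + (if (j < J)%N then `|ln (a j.+1)| / b j.+1 else 0)).
  move=> ajM; rewrite mul1r lerD2l mulrBl lerD//.
    by rewrite ler_wpM2r// /p le_max lexx orbT.
  case: ltnP => jJ; first by rewrite -mulNr ler_wpM2r// -normrN ler_norm.
  by rewrite oppr_le0 mulr_ge0// ln_a_ge0// ltnW.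
apply: le_trans (ler_sum _ split_le) _; rewrite big_split /= -mulr_suml.
have hc := ler_wpM2r lm_ge0 (count_le s M); rewrite -/p in hc.
apply: le_trans (lerD hc (lexx _)) _.
have h2 : \sum_(j < s | a j.+1 < M) (p * (b j.+1)^-1 +
      (if (j < J)%N then `|ln (a j.+1)| / b j.+1 else 0)) <=
    p * (B * (1 + ln s%:R)) + A0.
  rewrite big_mkcond /=; apply: (@le_trans _ _ (\sum_(j < s) (p * (b j.+1)^-1 +
      (if (j < J)%N then `|ln (a j.+1)| / b j.+1 else 0)))).
    apply: ler_sum => j _; case: ifP => // _; rewrite addr_ge0//.
      exact: mulr_ge0.
    by case: ifP => // _; exact: mulr_ge0.
  rewrite big_split /= -mulr_sumr lerD//; first by rewrite ler_wpM2l// hB.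
  rewrite /A0 -big_mkcond/= (big_ord_widen_cond (maxn s J) (fun j => (j < J)%N)
    (fun j => `|ln (a j.+1)| / b j.+1)) ?leq_maxl//.
  rewrite [leRHS](big_ord_widen (maxn s J)
    (fun j => `|ln (a j.+1)| / b j.+1)) ?leq_maxr// big_mkcond [leRHS]big_mkcond/=.
  apply: ler_sum => j _; case: (j < J)%N => //=; case: (j < s)%N => //.
  exact: mulr_ge0.
apply: le_trans (lerD (lexx _) h2) _.
by rewrite le_eqVlt; apply/orP; left; apply/eqP; field; rewrite gt_eqF.
Qed.

(** As [a] tends to infinity, only the coordinates [j < J1] can contribute, whatever [s] is. *)
Lemma log_count_bounded (P : R) :
  exists A, forall s M, ln M <= P -> log_count s M <= A.
Proof.
have [J1 hJ1] := ln_a_cvg P.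
have bV j : 0 <= (b j.+1)^-1 by rewrite invr_ge0 ltW// b_gt0.
pose G j := lm + (`|P| + `|ln (a j.+1)|) / b j.+1.
have G0 j : 0 <= G j by rewrite addr_ge0// mulr_ge0// addr_ge0.
exists (\sum_(j < J1) G j) => s M MP; rewrite /log_count.
(* For [M <= 0] the sum is empty, all [a j] being positive. *)
have [M0|M0] := ltP 0 M; last first.
  rewrite big1 ?sumr_ge0// => j; rewrite ltNge; case/negP.
  by rewrite (le_trans M0)// ltW// a_gt0.
apply: (@le_trans _ _ (\sum_(j < s | (j < J1)%N) G j)).
  rewrite big_mkcond [leRHS]big_mkcond /=; apply: ler_sum => j _.
  have [ajM|] := ltP (a j.+1) M; last by case: ifP.
  have -> : (j < J1)%N.
    rewrite ltnNge; apply/negP => J1j.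
    have := hJ1 j.+1 (leqW J1j); apply/negP; rewrite -leNgt (le_trans _ MP)//.
    by rewrite ler_ln ?posrE ?a_gt0// ltW.
  rewrite lerD2l ler_wpM2r// lerD ?(le_trans MP) ?ler_norm//.
  by rewrite -normrN ler_norm.
rewrite (big_ord_widen_cond (maxn s J1) (fun j => (j < J1)%N) G) ?leq_maxl//.
rewrite [leRHS](big_ord_widen (maxn s J1) G) ?leq_maxr// big_mkcond [leRHS]big_mkcond/=.
by apply: ler_sum => j _; case: (j < J1)%N => //=; case: (j < s)%N.
Qed.

(* [log_count_le] is off by the constant factor between [M] and [1 + kappa * M],
   which [delta] absorbs for large [M]; for the remaining [M] the count is bounded
   independently of [s]. *)
Lemma log_count_le_delta (B kappa delta : R) : 0 <= B -> 0 < kappa -> 1 < delta ->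
  (forall s, (1 <= s)%N -> \sum_(j < s) (b j.+1)^-1 <= B * (1 + ln s%:R)) ->
  exists A, forall s M, (1 <= s)%N -> 0 < M ->
    log_count s M <=
    A + delta * (B + lm / alp) * (1 + ln s%:R) * (1 + ln (1 + kappa * M)).
Proof.
move=> B0 k0 d1 /log_count_le[A1 hA1].
have T0 : 0 <= B + lm / alp by rewrite addr_ge0// mulr_ge0// invr_ge0 ltW.
(* With [x = ln (1 + kappa * M)] one has [ln M <= x + c], and [x + c <= delta * (1 + x)] holds
   exactly when [x >= X]. *)
pose c := - ln kappa; pose X := (c - delta) / (delta - 1).
have [A2 hA2] := log_count_bounded (X + c).
exists (Num.max A1 A2) => s M s1 M0.
have kM : 0 < kappa * M by exact: mulr_gt0.
set x := ln (1 + kappa * M).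
have x0 : 0 <= x by rewrite ln_ge0// lerDl ltW.
have Mx : ln M <= x + c.
  rewrite -lerBlDr opprK -lnM ?posrE// ler_ln ?posrE ?addr_gt0 ?mulr_gt0//.
  by rewrite [M * _]mulrC lerDr.
have s0 : 0 <= 1 + ln s%:R :> R by rewrite addr_ge0// ln_natr_ge0.
have [xd|xd] := leP (x + c) (delta * (1 + x)).
  apply: le_trans (hA1 s M s1) _; rewrite lerD ?le_max ?lexx//.
  rewrite [leRHS](_ : _ = (1 + ln s%:R) * (delta * (1 + x)) * (B + lm / alp)).
    rewrite ler_wpM2r// ler_wpM2l// ge_max (le_trans Mx)// andbT.
    by rewrite mulr_ge0 ?addr_ge0//; lra.
  by rewrite /x; ring.
apply: (@le_trans _ _ A2).
  apply: hA2; apply: (le_trans Mx); rewrite lerD2r /X ler_pdivlMr ?subr_gt0//.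
  by lra.
rewrite -[leLHS]addr0 lerD ?le_max ?lexx ?orbT//.
by rewrite !mulr_ge0// ?addr_ge0//; lra.
Qed.

End LogCount.

Lemma one_powR (R : realType) (x : R) : 1 `^ x = 1.
Proof. by rewrite powR1. Qed.

(** * Explicit boxes for the upper and lower bounds *)

Section ComplexityBounds.
Context (R : realType) (F : scalar_kind) (omega : R) (m : nat -> nat)
  (a b : nat -> R) (H : hilbert R F) (e : nat -> H) (s : nat) (Hs : hilbert R F)
  (t : ('I_s -> H) -> Hs).
Hypothesis omega01 : 0 < omega < 1.
Hypothesis e_basis : orthonormal_basis e.
Hypothesis t_tensor : tensor_power t.
Hypothesis m_gt0 : forall k, (0 < m k)%N.
Hypothesis a_gt0 : forall j, (1 <= j)%N -> 0 < a j.
Hypothesis b_gt0 : forall j, (1 <= j)%N -> 0 < b j.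
Local Notation N eps := (information_complexity omega m a b
  (fun n : {ffun 'I_s -> nat} => t (fun j => e (n j))) eps).
Local Notation M eps := (budget omega eps).

(** A coordinate can afford only blocks [k <= y j]. If [a j.+1] reaches the budget, only block 0
    remains, and it has one element because [m 0 = 1]. *)
Lemma complexity_le_log_count (mx eps : R) : m 0%N = 1%N -> 0 <= mx ->
  (forall k, (0 < k)%N -> (m k)%:R <= mx) -> 0 < eps -> 0 < M eps ->
  (N eps <= (expR (log_count a b (ln (1 + mx)) s (M eps)))%:E)%E.
Proof.
move=> m0 mx0 mmx eps0 M0; set B := M eps in M0 *.
pose y (j : nat) := (B / a j.+1) `^ (b j.+1)^-1.
pose c (j : 'I_s) := if a j.+1 < B then block_start m (Num.truncn (y j)).+1 else 1%N.
have y0 j : 0 <= y j by exact: powR_ge0.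
apply: (le_trans (complexity_le_box omega01 e_basis t_tensor a_gt0 eps0 (c := c) _)).
  move=> j k; have a0 := a_gt0 (isT : (1 <= j.+1)%N).
  have b0 := b_gt0 (isT : (1 <= j.+1)%N).
  rewrite -/B /c; case: ltP => [aB ck|Ba k1]; last first.
    apply: (le_trans Ba); rewrite ler_peMr// ?(ltW a0)//.
    rewrite -[leLHS](one_powR (b j.+1)); apply: ge0_ler_powR; rewrite ?nnegrE ?(ltW b0)//.
    by rewrite ler1n ltnNge block_index_leP// -leqNgt block_start1 m0.
  rewrite leNgt; apply/negP => h.
  suff /leq_trans/(_ ck) : (k < block_start m (Num.truncn (y j)).+1)%N by rewrite ltnn.
  rewrite -block_index_leP// Num.Theory.truncn_ge_nat ?y0//.
  have := h; rewrite mulrC -ltr_pdivlMr// => /ltW hB.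
  have := ge0_ler_powR (r := (b j.+1)^-1) _ _ _ hB.
  rewrite -powRrM mulfV ?gt_eqF// powRr1//; apply.
  - by rewrite invr_ge0 ltW.
  - by rewrite nnegrE powR_ge0.
  - by rewrite nnegrE divr_ge0// ltW.
rewrite lee_fin natr_prod /log_count expR_sum [leRHS]big_mkcond /=.
apply: ler_prod => j _; rewrite ler0n /c; case: ltP => //= aB.
have a0 := a_gt0 (isT : (1 <= j.+1)%N).
have Ba : 0 < B / a j.+1 by rewrite divr_gt0.
have yE : y j = expR ((ln B - ln (a j.+1)) / b j.+1).
  by rewrite /y /powR gt_eqF// ln_div ?posrE// mulrC.
have y1 : 1 <= y j.
  rewrite yE -expR0 ler_expR divr_ge0 ?(ltW (b_gt0 _))// subr_ge0.
  by rewrite ler_ln ?posrE// ltW.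
rewrite expRD lnK ?posrE ?ltr_wpDr// -yE.
have tr : (Num.truncn (y j))%:R <= y j by rewrite truncn_le.
(* Block 0 contributes 1 and each later block at most [mx]; since [1 <= y j], the total is at most
   [(1 + mx) * y j]. *)
apply: (@le_trans _ _ (1 + (Num.truncn (y j))%:R * mx)); last first.
  have : (Num.truncn (y j))%:R * mx <= y j * mx by rewrite ler_wpM2r.
  by lra.
rewrite /block_start big_ord_recl m0 natrD lerD2l natr_sum.
rewrite mulr_natl -[X in mx *+ X]card_ord -sumr_const; apply: ler_sum => i _.
exact: mmx.
Qed.

(** Each of the [s] coordinates may spend one share out of [s.+1], which leaves the total strictly
    below the budget. The bound [block_index m n <= n] makes every [n j <= y j] affordable. *)
Lemma complexity_ge_powers (eps : R) : 0 < eps -> 0 < M eps ->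
  ((expR (\sum_(j < s) (ln (M eps) - ln (s.+1%:R * a j.+1)) / b j.+1))%:E <= N eps)%E.
Proof.
move=> eps0 M0; set B := M eps in M0 *.
pose y (j : nat) := (B / (s.+1%:R * a j.+1)) `^ (b j.+1)^-1.
pose c (j : 'I_s) := (Num.truncn (y j)).+1.
apply: (le_trans _ (complexity_ge_box omega01 e_basis t_tensor eps0 (c := c) _)).
  rewrite lee_fin natr_prod expR_sum; apply: ler_prod => j _; rewrite expR_ge0 /=.
  apply: (@le_trans _ _ (y j)); last exact/ltW/truncnS_gt.
  have sa : 0 < s.+1%:R * a j.+1 by rewrite mulr_gt0// a_gt0.
  have Bsa : 0 < B / (s.+1%:R * a j.+1) by rewrite divr_gt0.
  by rewrite /y /powR gt_eqF// ln_div ?posrE// mulrC.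
move=> n nc; rewrite -/B; have s1 : 0 < s.+1%:R :> R by [].
apply: (@le_lt_trans _ _ (\sum_(j < s) B / s.+1%:R)); last first.
  rewrite sumr_const card_ord -[ltLHS]mulr_natl mulrA ltr_pdivrMr// mulrC ltr_pM2l//.
  by rewrite ltr_nat.
apply: ler_sum => j _; have b0 := b_gt0 (isT : (1 <= j.+1)%N).
have a0 := a_gt0 (isT : (1 <= j.+1)%N).
rewrite mulrC -ler_pdivlMr// -mulrA -invfM.
have ny : (block_index m (n j))%:R <= y j.
  apply: (@le_trans _ _ (n j)%:R); first by rewrite ler_nat block_index_le.
  by rewrite -truncn_ge_nat ?powR_ge0// -ltnS; exact: nc.
have := ge0_ler_powR (ltW b0) _ _ ny; rewrite !nnegrE ler0n powR_ge0 => /(_ isT isT).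
rewrite /y -powRrM mulVf ?gt_eqF// powRr1// divr_ge0// ?ltW// mulr_gt0//.
Qed.

(** Multi-indices with all coordinates in block 0 cost nothing. *)
Lemma complexity_ge_m0 (eps : R) : 0 < eps -> 0 < M eps ->
  ((m 0 ^ s)%:R%:E <= N eps)%E.
Proof.
move=> eps0 M0.
have := complexity_ge_box omega01 e_basis t_tensor eps0 (c := fun=> m 0%N).
rewrite prod_nat_const card_ord; apply => n nm.
rewrite /cost big1// => j _; have b0 := b_gt0 (isT : (1 <= j.+1)%N).
have : (block_index m (n j) <= 0)%N.
  by rewrite block_index_leP// block_start1.
by rewrite leqn0 => /eqP->; rewrite powR0 ?mulr0// gt_eqF.
Qed.

(** A coordinate in block 0 or 1 costs at most [a s] by monotonicity, so the total cost is at most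
    [s * a s]. *)
Lemma complexity_ge_m01 (eps : R) : (1 <= s)%N ->
  (forall j, (1 <= j)%N -> a j <= a j.+1) ->
  0 < eps -> s.+1%:R * a s <= M eps ->
  (((m 0 + m 1) ^ s)%:R%:E <= N eps)%E.
Proof.
move=> s1 a_ndecr eps0 M0.
have := complexity_ge_box omega01 e_basis t_tensor eps0 (c := fun=> (m 0 + m 1)%N).
rewrite prod_nat_const card_ord; apply => n nm.
have as0 := a_gt0 s1.
apply: lt_le_trans M0; apply: (@le_lt_trans _ _ (\sum_(j < s) a s)); last first.
  by rewrite sumr_const card_ord -[ltLHS]mulr_natl ltr_pM2r// ltr_nat.
have a_mono i j : (1 <= i)%N -> (i <= j)%N -> a i <= a j.
  move=> i1; elim: j => [|j IHj]; first by rewrite leqn0 => /eqP i0; rewrite i0 in i1.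
  rewrite leq_eqVlt => /predU1P[->//|ij]; apply: le_trans (IHj ij) _.
  exact/a_ndecr/(leq_trans i1).
apply: ler_sum => j _; have b0 := b_gt0 (isT : (1 <= j.+1)%N).
apply: (@le_trans _ _ (a j.+1)); last exact: a_mono.
rewrite ler_piMr ?(ltW (a_gt0 _))// -[leRHS](one_powR (b j.+1)).
apply: ge0_ler_powR; rewrite ?nnegrE ?(ltW b0)//.
by rewrite lern1 block_index_leP// block_start2.
Qed.

End ComplexityBounds.

(** * Extracting exponents from inequalities between logarithms *)

Section Asymptotics.
Context {R : realType}.
Implicit Types (A C D K S l r t : R).

Lemma natr_sqrt_large (Q : R) : exists J, forall s, (J <= s)%N ->
  (1 <= s)%N /\ Q < Num.sqrt (s%:R : R).
Proof.
exists (Num.truncn (Q ^+ 2)).+1 => s Js; split; first exact: leq_trans Js.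
apply: le_lt_trans (ler_norm Q) _; rewrite -sqrtr_sqr ltr_sqrt.
  by apply: lt_le_trans (truncnS_gt _) _; rewrite ler_nat.
by rewrite ltr0n (leq_trans _ Js).
Qed.

Lemma slope_le_of_log_growth (S D t kappa : R) : 0 <= t -> 0 < kappa ->
  (forall M, 0 < M -> S * ln M - D <= t * (1 + ln (1 + kappa * M))) -> S <= t.
Proof.
move=> t0 k0 h; rewrite leNgt; apply/negP => tS.
(* At [M = expR x] the hypothesis gives [(S - t) * x <= E], whereas this [x] makes the left side
   [|E| + 1]. *)
pose E := D + t * (1 + ln (1 + kappa)); pose x := (`|E| + 1) / (S - t).
have x0 : 0 < x by rewrite divr_gt0 ?subr_gt0// ltr_wpDl.
have := h _ (expR_gt0 x); rewrite expRK.
have e1 : 1 <= expR x by rewrite -expR0 ler_expR ltW.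
have : ln (1 + kappa * expR x) <= ln (1 + kappa) + x.
  have k1 : 0 < 1 + kappa by rewrite addr_gt0.
  have kx : 0 < 1 + kappa * expR x by rewrite addr_gt0// mulr_gt0// expR_gt0.
  rewrite -[X in _ <= _ + X](expRK x) -lnM ?posrE ?expR_gt0//.
  rewrite ler_ln ?posrE ?mulr_gt0 ?expR_gt0//.
  by rewrite mulrDl mul1r lerD2r.
move=> /(ler_wpM2l t0) h1 h2.
have : (S - t) * x <= E by rewrite /E; lra.
rewrite /x mulrC mulfVK ?gt_eqF ?subr_gt0//.
by have := ler_norm E; lra.
Qed.

Lemma linear_not_le_log l A K : 0 < l ->
  (forall s, (1 <= s)%N -> s%:R * l <= A + K * (1 + ln s%:R)) -> False.
Proof.
(* With [v = sqrt s >= 1], the right side is at most [Q * v], and the left side is [l * v ^+ 2]. *)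
move=> l0 h; pose Q := `|A| + 2 * `|K|.
have [J /(_ J (leqnn J))[s1]] := natr_sqrt_large (Q / l).
set v := Num.sqrt _; rewrite ltr_pdivrMr// => Qv.
have s0 : 0 < J%:R :> R by rewrite ltr0n.
have v1 : 1 <= v by rewrite -sqrtr1 ler_sqrt// ler1n.
have vv : v ^+ 2 = J%:R by rewrite sqr_sqrtr// ltW.
have := ln_le_sqrt s0; rewrite -/v => lnJ.
have := h J s1; rewrite -{1}vv => hJ.
have l1 : 0 <= 1 + ln J%:R :> R by rewrite addr_ge0// ln_natr_ge0.
have hK : K * (1 + ln J%:R) <= `|K| * (2 * v).
  apply: (@le_trans _ _ (`|K| * (1 + ln J%:R))); first by rewrite ler_wpM2r// ler_norm.
  by rewrite ler_wpM2l//; lra.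
have hA : A <= `|A| * v.
  by apply: le_trans (ler_norm _) _; rewrite ler_peMr.
have : v ^+ 2 * l <= Q * v by rewrite /Q; lra.
by rewrite expr2 -mulrA mulrC ler_pM2r ?(lt_le_trans ltr01)// leNgt Qv.
Qed.

(** All terms on the right except [t * (1 + ln s) * ln (a s)] are at most [Q * sqrt s]; once
    [sqrt s > Q / eta], they are absorbed by the gap [eta = l - t * r]. *)
Lemma log_ratio_eventually_ge (a : nat -> R) l t A K r : 0 < t ->
  (forall s, (1 <= s)%N ->
     s%:R * l <= A + t * (1 + ln s%:R) * (K + ln s.+1%:R + ln (a s))) ->
  r < l / t ->
  exists J, forall s, (J <= s)%N -> r <= (1 + ln s%:R) * ln (a s) / s%:R.
Proof.
move=> t0 h rl; pose Q := `|A| + 4 * t * (`|K| + 4); pose eta := l - t * r.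
have eta0 : 0 < eta by move: rl; rewrite ltr_pdivlMr// mulrC subr_gt0.
have [J hJ] := natr_sqrt_large (Q / eta).
exists J => s /hJ[s1]; set v := Num.sqrt _; rewrite ltr_pdivrMr// => Qv.
have s0 : 0 < s%:R :> R by rewrite ltr0n.
have v1 : 1 <= v by rewrite -sqrtr1 ler_sqrt// ler1n.
have vv : v ^+ 2 = s%:R by rewrite sqr_sqrtr// ltW.
have := ln_le_sqrt_sqrt s0; rewrite -/v; set u := Num.sqrt v => lns.
have u1 : 1 <= u by rewrite -sqrtr1 ler_wsqrtr.
have uu : u ^+ 2 = v by rewrite sqr_sqrtr// (le_trans ler01).
(* From [s + 1 <= 2 * s <= expR 1 * s]. *)
have lnS : ln s.+1%:R <= 1 + ln s%:R :> R.
  rewrite -[X in _ <= X + _](expRK 1) -lnM ?posrE ?expR_gt0// ler_ln ?posrE ?mulr_gt0 ?expR_gt0//.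
  apply: (@le_trans _ _ (2 * s%:R)).
    by rewrite -natrM ler_nat mul2n -addnn -addn1 leq_add2l.
  by rewrite ler_pM2r//; have := expR_ge1Dx (1 : R); lra.
have l1 : 0 <= 1 + ln s%:R :> R by rewrite addr_ge0// ln_natr_ge0.
have hK : (1 + ln s%:R) * (K + ln s.+1%:R) <= 4 * (`|K| + 4) * v.
  apply: (@le_trans _ _ ((1 + ln s%:R) * ((`|K| + 4) * u))).
    rewrite ler_wpM2l//; have := ler_norm K.
    have : `|K| <= `|K| * u by rewrite ler_peMr.
    lra.
  rewrite -uu expr2 [leRHS](_ : _ = (4 * u) * ((`|K| + 4) * u)); last by ring.
  rewrite ler_wpM2r//; last by lra.
  by rewrite mulr_ge0// ?addr_ge0//; lra.
have hA : A <= `|A| * v by apply: le_trans (ler_norm _) _; rewrite ler_peMr.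
have := h s s1; rewrite mulrDr => hs.
have hK' := ler_wpM2l (ltW t0) hK.
have Qv' : Q * v < v * eta * v by rewrite ltr_pM2r// (lt_le_trans ltr01).
rewrite ler_pdivlMr// -(ler_pM2l t0) mulrA.
have -> : t * r = l - eta by rewrite /eta; ring.
have : v * eta * v = eta * s%:R by rewrite -vv; ring.
rewrite /Q in Qv'; lra.
Qed.

Lemma limn_einf_ge (u : nat -> R) r J : (forall n, (J <= n)%N -> r <= u n) ->
  (r%:E <= limn_einf (fun n => (u n)%:E))%E.
Proof.
move=> h; rewrite limn_einf_lim (cvg_lim _ (@cvg_einfs_sup _ _))//.
apply: le_trans (ereal_sup_ubound _); last by exists J.
by apply: le_ereal_inf_tmp => _ [n /= Jn <-]; rewrite lee_fin h.
Qed.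

(** The limit inferior is the supremum of the tail infima, so some tail infimum already exceeds
    [r]. *)
Lemma limn_einf_gt (u : nat -> R) r : (r%:E < limn_einf (fun n => (u n)%:E))%E ->
  exists J, forall n, (J <= n)%N -> r <= u n.
Proof.
rewrite limn_einf_lim (cvg_lim _ (@cvg_einfs_sup _ _))//.
move=> /ereal_sup_gt[_ [J _ <-]] rJ; exists J => n Jn.
rewrite -lee_fin; apply: (le_trans (ltW rJ)); apply: ereal_inf_lbound.
by exists n.
Qed.

End Asymptotics.

(** * From EC-QPT bounds to conditions on the parameters, and back *)

Section Exponent.
Context (R : realType) (F : scalar_kind)
  (H : hilbert R F) (e : nat -> H) (he : orthonormal_basis e)
  (Hs : nat -> hilbert R F) (tens : forall s : nat, ('I_s -> H) -> Hs s)
  (htens : forall s : nat, (1 <= s)%N -> tensor_power (tens s))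
  (omega : R) (homega : 0 < omega < 1)
  (m : nat -> nat) (m_gt0 : forall k : nat, (0 < m k)%N)
  (m_bounded : exists M : nat, forall k : nat, (m k <= M)%N)
  (a b : nat -> R)
  (a_gt0 : forall j : nat, (1 <= j)%N -> 0 < a j)
  (a_ndecr : forall j : nat, (1 <= j)%N -> a j <= a j.+1)
  (b_gt0 : forall j : nat, (1 <= j)%N -> 0 < b j).

Local Notation N := (fun (s : nat) (eps : R) => information_complexity omega m a b
  (fun n : {ffun 'I_s -> nat} => tens (fun j => e (n j))) eps).
Local Notation kappa := (ln omega^-1 / 2).

Let kappa_gt0 : 0 < kappa.
Proof. by rewrite divr_gt0// ln_omegaV_gt0. Qed.

Lemma budget_gt0 eps : 0 < eps < 1 -> 0 < budget omega eps.
Proof.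
move=> /andP[eps0 eps1]; rewrite divr_gt0 ?ln_omegaV_gt0// mulr_gt0//.
by rewrite ln_gt0// invf_gt1.
Qed.

Lemma kappa_budget eps : kappa * budget omega eps = ln eps^-1.
Proof.
by rewrite /budget; field; rewrite gt_eqF// ln_omegaV_gt0.
Qed.

(** Allows the EC-QPT bound to be tested at any prescribed positive budget. *)
Lemma budget_onto (M : R) : 0 < M ->
  exists2 eps, 0 < eps < 1 & budget omega eps = M.
Proof.
move=> M0; exists (expR (- (kappa * M))).
  by rewrite expR_gt0 expR_lt1 oppr_lt0 mulr_gt0.
rewrite /budget -expRN opprK expRK; field.
by rewrite gt_eqF// ln_omegaV_gt0.
Qed.

Section Necessity.
Context (C t : R) (C_gt0 : 0 < C) (t_gt0 : 0 < t) (bound : ec_qpt_bound N C t).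

Let ln_le_bound s eps (x : R) : (1 <= s)%N -> 0 < eps < 1 -> 0 < x ->
  (x%:E <= N s eps)%E ->
  ln x <= ln C + t * (1 + ln s%:R) * (1 + ln (1 + kappa * budget omega eps)).
Proof.
move=> s1 eps01 x0 /le_trans/(_ (bound s1 eps01)); rewrite lee_fin kappa_budget => h.
have P0 := mulr_gt0 C_gt0 (expR_gt0 (t * (1 + ln s%:R) * (1 + ln (1 + ln eps^-1)))).
by rewrite -[leRHS]expRK expRD lnK ?posrE// ler_ln ?posrE.
Qed.

Lemma bound_m0 : m 0%N = 1%N.
Proof.
(* At budget 1, [m 0 > 1] would make the logarithm of the count grow linearly in [s], while the
   bound allows only growth of order [ln s]. *)
have [eps eps01 epsM] := budget_onto ltr01.
have eps0 : 0 < eps by have /andP[] := eps01.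
apply/eqP; rewrite eqn_leq m_gt0 andbT leqNgt; apply/negP => m1.
apply: (@linear_not_le_log _ (ln (m 0%N)%:R) (ln C) (t * (1 + ln (1 + kappa)))).
  by rewrite ln_gt0// ltr1n.
move=> s s1; have m0s : 0 < (m 0%N ^ s)%:R :> R by rewrite ltr0n expn_gt0 m_gt0.
have := ln_le_bound s1 eps01 m0s (complexity_ge_m0 a homega he (htens s1) m_gt0
  b_gt0 eps0 (budget_gt0 eps01)).
rewrite epsM mulr1 natrX lnXn ?ltr0n// mulr_natl => /le_trans; apply.
by rewrite lerD2l mulrAC.
Qed.

(** For fixed [s], compare the coefficients of [ln M]: the lower bound has the sum of the [1 / b_j],
    the EC-QPT bound has [t * (1 + ln s)]. *)
Lemma bound_Bstar : (Bstar b <= t%:E)%E.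
Proof.
apply: ge_ereal_sup => _ [s /= s1 <-]; rewrite lee_fin big_add1 big_mkord /=.
have l1 : 0 < 1 + ln s%:R :> R by rewrite ltr_pwDl// ln_natr_ge0.
rewrite ler_pdivrMr//.
apply: (@slope_le_of_log_growth _ _
  (ln C + \sum_(j < s) ln (s.+1%:R * a j.+1) / b j.+1) _ kappa) => //.
  by rewrite mulr_ge0// ltW.
move=> M M0; have [eps eps01 epsM] := budget_onto M0.
have eps0 : 0 < eps by have /andP[] := eps01.
have := complexity_ge_powers homega he (htens s1) m_gt0 a_gt0 b_gt0 eps0 (budget_gt0 eps01).
move=> /(ln_le_bound s1 eps01 (expR_gt0 _)); rewrite expRK epsM.
rewrite lerBlDr => h; apply: le_trans (_ : _ <= _ + \sum_(j < s) ln (s.+1%:R * a j.+1) / b j.+1) _.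
  have -> : (\sum_(j < s) (b j.+1)^-1) * ln M =
      \sum_(j < s) (ln M - ln (s.+1%:R * a j.+1)) / b j.+1 +
      \sum_(j < s) ln (s.+1%:R * a j.+1) / b j.+1.
    by rewrite -big_split mulr_suml; apply: eq_bigr => j _ /=; rewrite -mulrDl subrK mulrC.
  by rewrite lerD2r; exact: h.
by lra.
Qed.

Lemma bound_alpha : ((ln (1 + (m 1%N)%:R) / t)%:E <= alpha a)%E.
Proof.
(* Every budget [M = (s + 1) * a s] is at least [a 1], so this [K] gives
   [1 + kappa * M <= K * M]. *)
set l := ln _; pose K := kappa + (a 1%N)^-1.
have K0 : 0 < K by rewrite addr_gt0// invr_gt0 a_gt0.
have a_ge1 s : (1 <= s)%N -> a 1%N <= a s.
  by case: s => // + _; elim=> // s IHs; rewrite (le_trans IHs)// a_ndecr.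
have hs s : (1 <= s)%N -> s%:R * l <= ln C + t * (1 + ln s%:R) *
    (1 + ln K + ln s.+1%:R + ln (a s)).
  move=> s1; have as0 := a_gt0 s1.
  have sa0 : 0 < s.+1%:R * a s by rewrite mulr_gt0.
  have [eps eps01 epsM] := budget_onto sa0.
  have eps0 : 0 < eps by have /andP[] := eps01.
  have := complexity_ge_m01 homega he (htens s1) m_gt0 a_gt0 b_gt0 s1 a_ndecr eps0.
  rewrite epsM => /(_ (lexx _)) h.
  have m01 : 0 < ((m 0 + m 1) ^ s)%:R :> R by rewrite ltr0n expn_gt0 addn_gt0 m_gt0.
  have := ln_le_bound s1 eps01 m01 h; rewrite epsM bound_m0.
  rewrite natrX lnXn ?natrD ?ltr_wpDr// -/l -[X in X <= _ -> _]mulr_natl => /le_trans; apply.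
  rewrite lerD2l ler_wpM2l//.
    by rewrite mulr_ge0// ?(ltW t_gt0)// addr_ge0// ln_natr_ge0.
  rewrite -!addrA lerD2l -!lnM ?posrE ?mulr_gt0//.
  have kM := mulr_gt0 kappa_gt0 sa0; have KM := mulr_gt0 K0 sa0.
  rewrite ler_ln ?posrE// ?addr_gt0//.
  rewrite /K mulrDl addrC lerD2l ler_pdivlMl// ?a_gt0// mulr1.
  apply: le_trans (a_ge1 s s1) _.
  by rewrite ler_peMl ?(ltW as0)// ler1n.
apply/lee_subgt0Pr => d d0; rewrite -EFinB.
have [|J hJ] := log_ratio_eventually_ge t_gt0 hs (r := l / t - d); first by lra.
exact: limn_einf_ge hJ.
Qed.

End Necessity.

Lemma m_le_max k : (0 < k)%N -> (m k)%:R <= m_max R m.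
Proof.
move=> k0; have [M mM] := m_bounded; apply: ub_le_sup; last by exists k.
by exists M%:R => _ [i _ <-]; rewrite ler_nat.
Qed.

Lemma Bstar_le_sum (B : R) : Bstar b = B%:E ->
  forall s, (1 <= s)%N -> \sum_(j < s) (b j.+1)^-1 <= B * (1 + ln s%:R).
Proof.
move=> BE s s1; have l1 : 0 < 1 + ln s%:R :> R by rewrite ltr_pwDl// ln_natr_ge0.
rewrite -ler_pdivrMr// -lee_fin -BE; apply: ereal_sup_ubound; exists s => //.
by rewrite big_add1 big_mkord.
Qed.

(* [q] stands for any real above [1 / alpha a]. *)
Lemma ec_qpt_bound_suff (B q t : R) : m 0%N = 1%N -> Bstar b = B%:E ->
  0 < q -> ((q^-1)%:E < alpha a)%E -> B + ln (1 + m_max R m) * q < t ->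
  exists2 C, 0 < C & ec_qpt_bound N C t.
Proof.
move=> m0 BE q0 qa Bt; set lm := ln _ in Bt.
have mx1 : 1 <= m_max R m.
  by apply: le_trans (m_le_max (isT : (0 < 1)%N)); rewrite ler1n.
have lm0 : 0 < lm by rewrite ln_gt0//; lra.
have hB := Bstar_le_sum BE.
have B0 : 0 < B.
  have := hB 1%N isT; rewrite big_ord1 ln1 addr0 mulr1; apply: lt_le_trans.
  by rewrite invr_gt0 b_gt0.
have [J hJ] := limn_einf_gt qa.
(* The threshold [J.+1] ensures [0 < j], so that multiplying by [j] is legitimate. *)
have growth j : (J.+1 <= j)%N -> q^-1 * j%:R <= (1 + ln j%:R) * ln (a j).
  move=> Jj; rewrite -ler_pdivlMr ?ltr0n ?(leq_trans _ Jj)//.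
  exact/hJ/ltnW.
have T0 : 0 < B + lm / q^-1 by rewrite invrK addr_gt0// mulr_gt0.
(* The strict inequality assumed for [t] makes [delta > 1], and the resulting slope is exactly
   [t]. *)
pose delta := t / (B + lm / q^-1).
have d1 : 1 < delta by rewrite ltr_pdivlMr// mul1r invrK.
have qV0 : 0 < q^-1 by rewrite invr_gt0.
have [A hA] := log_count_le_delta a_gt0 b_gt0 (ltW lm0) qV0 growth
  (ltW B0) kappa_gt0 d1 hB.
exists (expR A); first exact: expR_gt0.
move=> s eps s1 eps01; have [eps0 _] := andP eps01.
have M0 := budget_gt0 eps01.
have mx0 : 0 <= m_max R m by lra.
apply: le_trans (complexity_le_log_count homega he (htens s1) m_gt0 a_gt0 b_gt0
  m0 mx0 m_le_max eps0 M0) _.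
rewrite lee_fin -expRD ler_expR.
have := hA s _ s1 M0; rewrite kappa_budget /delta mulfVK ?gt_eqF//.
Qed.

End Exponent.

Theorem theorem8 (R : realType) (F : scalar_kind)
    (H : hilbert R F) (e : nat -> H) (he : orthonormal_basis e)
    (Hs : nat -> hilbert R F) (tens : forall s : nat, ('I_s -> H) -> Hs s)
    (htens : forall s : nat, (1 <= s)%N -> tensor_power (tens s))
    (omega : R) (homega : 0 < omega < 1)
    (m : nat -> nat) (m_gt0 : forall k : nat, (0 < m k)%N)
    (m_bounded : exists M : nat, forall k : nat, (m k <= M)%N)
    (a b : nat -> R)
    (a_gt0 : forall j : nat, (1 <= j)%N -> 0 < a j)
    (a_ndecr : forall j : nat, (1 <= j)%N -> a j <= a j.+1)
    (b_gt0 : forall j : nat, (1 <= j)%N -> 0 < b j)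
    (inf_b_gt0 : 0 < inf [set b j | j in [set j : nat | (1 <= j)%N]]) :
  let basis (s : nat) (n : {ffun 'I_s -> nat}) : Hs s :=
    tens s (fun j => e (n j)) in
  let N (s : nat) (eps : R) : \bar R :=
    information_complexity omega m a b (@basis s) eps in
  [/\ ec_qpt N <-> [/\ m 0%N = 1%N, (Bstar b < +oo)%E & (0 < alpha a)%E],
      ec_qpt N ->
        (Order.max (Bstar b) ((ln (1 + (m 1%N)%:R))%:E / alpha a)
           <= ec_qpt_exponent N
           <= Bstar b + (ln (1 + m_max R m))%:E / alpha a)%E
    & ec_qpt N -> alpha a = +oo%E -> ec_qpt_exponent N = Bstar b].
Proof.
move=> basis N.
have w0 := ln_omegaV_gt0 homega.
have necessary C t : 0 < C -> 0 < t -> ec_qpt_bound N C t ->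
    [/\ m 0%N = 1%N, (Bstar b <= t%:E)%E & ((ln (1 + (m 1%N)%:R) / t)%:E <= alpha a)%E].
  move=> C0 t0 bnd; split.
  - exact: (bound_m0 he htens homega m_gt0 b_gt0 C0 bnd).
  - exact: (bound_Bstar he htens homega m_gt0 a_gt0 b_gt0 C0 t0 bnd).
  - exact: (bound_alpha he htens homega m_gt0 a_gt0 a_ndecr b_gt0 C0 t0 bnd).
have Bpos : (0 < Bstar b)%E.
  apply: (@lt_le_trans _ _ ((b 1%N)^-1)%:E); first by rewrite lte_fin invr_gt0 b_gt0.
  by apply: ereal_sup_ubound; exists 1%N => //; rewrite big_nat1 ln1 addr0 divr1.
pose l : R := ln (1 + (m 1%N)%:R); pose lm := ln (1 + m_max R m).
have l0 : 0 < l by rewrite ln_gt0// ltrDl ltr0n.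
have m1max := m_le_max R m_bounded (isT : (0 < 1)%N).
have lm0 : 0 < lm by rewrite ln_gt0// ltrDl (lt_le_trans _ m1max)// ltr0n.
(* Serves twice: any [d] yields EC-QPT, and arbitrarily small [d] yield the upper bound on the
   exponent. *)
have sufficient : m 0%N = 1%N -> (Bstar b < +oo)%E -> (0 < alpha a)%E ->
    forall d : R, 0 < d -> exists t : R, [/\ 0 < t,
      (t%:E <= Bstar b + lm%:E / alpha a + d%:E)%E &
      exists2 C, 0 < C & ec_qpt_bound N C t].
  move=> m0 Bfin apos d d0.
  have [B BE] : exists B, Bstar b = B%:E.
    by case: (Bstar b) Bpos Bfin => // B _ _; exists B.
  have B0 : 0 < B by rewrite -lte_fin -BE.
  (* [ia] is [1 / alpha], read as 0 when [alpha] is infinite. *)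
  have [ia [ia0 iaE iaq]] : exists ia : R, [/\ 0 <= ia,
      (lm%:E / alpha a = (lm * ia)%:E)%E &
      forall q, ia < q -> ((q^-1)%:E < alpha a)%E].
    case: (alpha a) apos => [x||]//; last first.
      by move=> _; exists 0; split=> [||q _] //; rewrite ?invey ?mule0 ?mulr0 ?ltry.
    rewrite lte_fin => x0; exists x^-1; split=> [||q xq].
    - by rewrite invr_ge0 ltW.
    - by rewrite inver gt_eqF.
    - by rewrite lte_fin -[ltRHS]invrK ltf_pV2 ?posrE ?invr_gt0// (lt_trans _ xq) ?invr_gt0.
  (* Exceeding [ia] by this much costs [d / 2] in the exponent; the other [d / 2] gives the strict
     inequality. *)
  pose q := ia + d / (2 * lm).
  have dq : 0 < d / (2 * lm) by rewrite divr_gt0// mulr_gt0.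
  have qE : lm * q = lm * ia + d / 2 by rewrite /q; field; rewrite gt_eqF.
  have lia : 0 <= lm * ia by rewrite mulr_ge0// ltW.
  exists (B + lm * ia + d); split; first by lra.
    by rewrite BE iaE -!EFinD.
  apply: (ec_qpt_bound_suff he htens homega m_gt0 m_bounded a_gt0 b_gt0 m0 BE (q := q)).
  - by rewrite /q; lra.
  - by apply: iaq; rewrite /q; lra.
  - by rewrite -/lm qE; lra.
have charac : ec_qpt N <-> [/\ m 0%N = 1%N, (Bstar b < +oo)%E & (0 < alpha a)%E].
  split=> [[C [t [C0 t0 /(necessary _ _ C0 t0)[m0 Bt lt_a]]]]|[m0 Bfin apos]].
    split=> //; first by rewrite (le_lt_trans Bt)// ltry.
    by apply: lt_le_trans lt_a; rewrite lte_fin divr_gt0.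
  have [t [t0 _ [C C0 bnd]]] := sufficient m0 Bfin apos 1 ltr01.
  by exists C, t.
have exponent_bounds : ec_qpt N ->
    (Order.max (Bstar b) (l%:E / alpha a) <= ec_qpt_exponent N
       <= Bstar b + lm%:E / alpha a)%E.
  move=> /charac[m0 Bfin apos]; apply/andP; split.
    apply: le_ereal_inf_tmp => _ [t [t0 [C C0 /(necessary _ _ C0 t0)[_ Bt lt_a]]] <-].
    rewrite ge_max Bt /=; case: (alpha a) apos lt_a => [x||]//.
      rewrite !lte_fin !lee_fin => x0; rewrite inver gt_eqF// -EFinM lee_fin.
      by rewrite ler_pdivrMr// mulrC ler_pdivrMr.
    by move=> _ _; rewrite invey mule0 lee_fin ltW.
  apply/lee_addgt0Pr => d d0.
  have [t [t0 td bnd]] := sufficient m0 Bfin apos d d0.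
  by apply: le_trans td; apply: ereal_inf_lbound; exists t.
split=> // hN ainf; have := exponent_bounds hN.
(* Both quotients by [alpha] vanish, and the two bounds meet at [Bstar b]. *)
rewrite ainf invey !mule0 adde0 ge_max => /andP[/andP[Bt _] tB].
by apply/eqP; rewrite eq_le tB Bt.
Qed.
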